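(* Let $\{W_t\}_{t\in\mathbb{Z}_+}$ be a sequence of discrete channels for which there is a function $g:(0,1)\to\mathbb{R}_+$ such that (i) $\lim_{n\to\infty}\frac1nC_{\alpha,W_{[1,n]}}=g(\alpha)$ for all $\alpha\in(0,1)$; (ii) $\lim_{\alpha\uparrow1}\frac{1-\alpha}{\alpha}g(\alpha)=0$; (iii) there exist $K\in\mathbb{R}_+$ and $n_0\in\mathbb{Z}_+$ with $\sup_{\alpha\in(0,1)}\sup_{t\in\mathbb{Z}_+}|C_{\alpha,W_{[t,t+n-1]}}-ng(\alpha)|\le K\ln n$ for all $n\ge n_0$. Let $0<\alpha_0<\alpha_1<1$. Then for any sequence of codes, the $n$-th being an $(M_n,L_n)$ channel code on the discrete product channel with feedback $W_{\vec{[1,n]}}$ with average error probability $P_e^{(n)}$, satisfying $$C_{\alpha_1,W_{[1,n]}}\ge\ln\frac{M_n}{L_n}\ge C_{\alpha_0,W_{[1,n]}}+(K+1)n^{3/4}\ln n\quad\forall n\ge n_0,$$ there exists $n_1\ge n_0$ such that $$P_e^{(n)}\ge\exp\Big(-E_{sp}\big(\ln\tfrac{M_n}{L_n},W_{[1,n]}\big)-\tfrac{6K+1}{\alpha_0}n^{3/4}\ln n\Big)\quad\forall n\ge n_1.$$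
   Context: A discrete channel is a map from a finite input set to probability distributions on a finite output set. $W_{[t,t+n-1]}$ denotes the product channel (without feedback) with input set $\mathcal{X}_t\times\cdots\times\mathcal{X}_{t+n-1}$ and $W_{[t,t+n-1]}(y|x)=\prod_{s}W_s(y_s|x_s)$. The length $n$ discrete product channel with feedback $W_{\vec{[1,n]}}$ has input set $\mathcal{X}_1\times\prod_{t=2}^n\mathcal{X}_t^{\mathsf{Y}_1\times\cdots\times\mathsf{Y}_{t-1}}$ (inputs $(x_1,e_2,\dots,e_n)$), output set $\mathsf{Y}_1\times\cdots\times\mathsf{Y}_n$, and $W(y|x)=W_1(y_1|x_1)\prod_{t=2}^nW_t(y_t|e_t(y_1,\dots,y_{t-1}))$. An $(M,L)$ channel code: encoder $f:\{1,\dots,M\}\to$ input set, decoder $\psi$ from outputs to $L$-element subsets of $\{1,\dots,M\}$; $P_e=\frac1M\sum_mW(f(m))(\{y:m\notin\psi(y)\})$. Rényi information $I_\alpha(p;W)=\frac{\alpha}{\alpha-1}\ln\sum_y(\sum_xp(x)W(y|x)^\alpha)^{1/\alpha}$ ($\alpha\ne1$), $I_1$ the mutual information; Rényi capacity $C_{\alpha,W}=\sup_pI_\alpha(p;W)$. Sphere packing exponent $E_{sp}(R,W)=\sup_{\alpha\in(0,\infty)}\frac{1-\alpha}{\alpha}(C_{\alpha,W}-R)$. *)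

(* Defs.v *)
From HB Require Import structures.
From mathcomp Require Import all_boot all_order all_algebra.
From mathcomp Require Import all_classical all_reals all_analysis.
Set Implicit Arguments. Unset Strict Implicit. Unset Printing Implicit Defensive.
Import Order.TTheory GRing.Theory Num.Theory.
Import numFieldNormedType.Exports.
Local Open Scope classical_set_scope.
Local Open Scope ring_scope.

Section Channels.
Variable R : realType.

Definition is_channel (X Y : finType) (W : X -> Y -> R) : Prop :=
  forall x, (forall y, 0 <= W x y) /\ \sum_(y : Y) W x y = 1.

Definition distributions (X : finType) : set {ffun X -> R} :=
  [set p | (forall x, 0 <= p x) /\ \sum_(x : X) p x = 1].

Definition mutual_info (X Y : finType) (p : {ffun X -> R}) (W : X -> Y -> R) : R :=
  \sum_(x : X) \sum_(y : Y)
     p x * W x y * ln (W x y / (\sum_(x' : X) p x' * W x' y)).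

Definition renyi_info (X Y : finType) (a : R) (p : {ffun X -> R}) (W : X -> Y -> R) : R :=
  if a == 1 then mutual_info p W
  else a / (a - 1) *
       ln (\sum_(y : Y) (\sum_(x : X) p x * (W x y `^ a)) `^ (a^-1)).

Definition renyi_cap (X Y : finType) (a : R) (W : X -> Y -> R) : R :=
  sup [set renyi_info a p W | p in @distributions X].

Definition Esp (X Y : finType) (r : R) (W : X -> Y -> R) : \bar R :=
  ereal_sup [set (((1 - a) / a) * (renyi_cap a W - r))%:E | a in `]0, +oo[].

Definition prod_in (X : nat -> finType) (t n : nat) : finType :=
  {dffun forall i : 'I_n, X (t + i)%N}.

Definition prod_chan (X Y : nat -> finType) (W : forall t, X t -> Y t -> R)
    (t n : nat) : prod_in X t n -> prod_in Y t n -> R :=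
  fun x y => \prod_(i < n) W (t + i)%N (x i) (y i).

(* length n product channel with feedback W_{->[1,n]}:
   the i-th component (i < n, i.e. time i+1) of the input is a map from
   Y_1 x ... x Y_i to X_{i+1} (for i = 0 the domain is a singleton, so this
   component is just an element of X_1). *)
Definition fb_in (X Y : nat -> finType) (n : nat) : finType :=
  {dffun forall i : 'I_n, {ffun {dffun forall j : 'I_i, Y (1 + j)%N} -> X (1 + i)%N}}.

Definition fb_out (Y : nat -> finType) (n : nat) : finType := prod_in Y 1 n.

Definition prefix (Y : nat -> finType) (n : nat) (y : fb_out Y n) (i : 'I_n) :
    {dffun forall j : 'I_i, Y (1 + j)%N} :=
  [ffun j : 'I_i => y (widen_ord (ltnW (ltn_ord i)) j)].

Definition fb_chan (X Y : nat -> finType) (W : forall t, X t -> Y t -> R)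
    (n : nat) : fb_in X Y n -> fb_out Y n -> R :=
  fun e y => \prod_(i < n) W (1 + i)%N (e i (prefix y i)) (y i).

Definition avg_err (In Out : finType) (V : In -> Out -> R) (M : nat)
    (f : 'I_M -> In) (psi : Out -> {set 'I_M}) : R :=
  (M%:R)^-1 * \sum_(m < M) \sum_(y : Out | m \notin psi y) V (f m) y.

End Channels.

Arguments prod_chan {R X Y} W t n.
Arguments fb_chan {R X Y} W n.
Arguments avg_err {R In Out} V {M} f psi.
Arguments renyi_cap {R X Y} a W.
Arguments Esp {R X Y} r W.

(* Main.v *)
Require Import Defs.
From HB Require Import structures.
From mathcomp Require Import all_boot all_order all_algebra.
From mathcomp Require Import all_classical all_reals all_analysis.
From mathcomp Require Import zify ring lra.
Import Order.TTheory GRing.Theory Num.Theory.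
Import numFieldNormedType.Exports.
Local Open Scope classical_set_scope.
Local Open Scope ring_scope.
Set Implicit Arguments.
Unset Strict Implicit.

(** Augustin's argument.  A Renyi center of order [a] of each letter channel [W_t]
    gives a product output law [q_a] with [D_a(w || q_a)] at most the sum of the
    letter capacities for every feedback strategy [w] (chain rule), and this sum is
    at most the capacity of the product channel.  Cut the [n] uses into about
    [sqrt n] blocks of length about [sqrt n].  In a block, given the past, tilt [w]
    towards [q_a]: the tilted law [v_a] satisfies
    [D(v_a || w) = (1 - a) / a * (D_a(w || q_a) - D(v_a || q_a))].  Over a grid of
    [n] orders between [a0] and [1 - n^(-1/4)], mix the two neighbouring tilted laws
    whose divergence to the output law crosses the block rate: the mixture has
    divergence to [w] at most the block exponent, and divergence to the average of
    the [q_a] over the grid (which does not depend on the message) at most the block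
    rate plus [ln (n + 1)].  Both log-likelihood ratios have conditional variance
    [O(n)] per block, so over the [sqrt n] blocks a supermartingale Chebyshev bound
    gives fluctuations [O(n^(3/4))], and a change of measure finishes the proof.
    Output alphabets being finite, [g] is bounded. *)

(** * Scalar inequalities *)

Section RealInequalities.
Context {R : realType}.
Implicit Types (x y z u v t a r : R).

Lemma ln_le_subr1 x : 0 < x -> ln x <= x - 1.
Proof.
move=> x0; have := @le_ln1Dx R (x - 1).
by rewrite (addrC 1) subrK; apply; lra.
Qed.

(** Weighted AM-GM: Young's inequality for [u^a] and [v^(1-a)] with the conjugate exponents [1/a]
    and [1/(1-a)]. *)
Lemma young u v a : 0 <= u -> 0 <= v -> 0 < a < 1 ->
  u `^ a * v `^ (1 - a) <= a * u + (1 - a) * v.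
Proof.
move=> u0 v0 /andP[a0 a1].
have b0 : 0 < 1 - a by lra.
have := @conjugate_powR R (u `^ a) (v `^ (1 - a)) a^-1 (1 - a)^-1.
rewrite !powR_ge0 !invr_gt0 a0 b0 !invrK -!powRrM !divff ?lt0r_neq0//.
rewrite !powRr1// [a * u]mulrC [_ * v]mulrC; apply => //; first by rewrite addrC subrK.
Qed.

(** The tangent at [u] lies below the convex function [x^r]. It is [young] for [x^r] and [u^r] with
    weights [1/r] and [1 - 1/r], so no derivative is taken. *)
Lemma powR_tangent u x r : 0 <= u -> 0 <= x -> 1 < r ->
  u `^ r + r * (u `^ (r - 1) * (x - u)) <= x `^ r.
Proof.
move=> u0 x0 r1; have r0 : 0 < r by lra.
have V0 : 0 < r^-1 by rewrite invr_gt0.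
have V1 : r^-1 < 1 by rewrite invf_lt1.
have V01 : 0 < r^-1 < 1 by rewrite V0 V1.
have := young (powR_ge0 x r) (powR_ge0 u r) V01.
rewrite -!powRrM mulfV ?lt0r_neq0// powRr1// mulrBr mulr1 mulfV ?lt0r_neq0//.
rewrite mulrBr [_ * u]mulrC mulr_powRB1//.
rewrite -(ler_pM2l r0) mulrDr !mulrA mulfV ?lt0r_neq0// mul1r mulrBr mulfV ?lt0r_neq0//; lra.
Qed.

(** Only upward deviations of a log-likelihood ratio harm a change of measure, so all fluctuations
    are measured through the positive part. *)
Definition pos x := Num.max x 0.

Lemma pos_ge0 x : 0 <= pos x.
Proof. by rewrite le_max lexx orbT. Qed.

Lemma le_pos x : x <= pos x.
Proof. by rewrite le_max lexx. Qed.

Lemma pos_le x y : 0 <= y -> x <= y -> pos x <= y.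
Proof. by move=> y0 xy; rewrite ge_max xy. Qed.

Lemma posE x : (pos x = x /\ 0 <= x) \/ (pos x = 0 /\ x <= 0).
Proof. by rewrite /pos maxEle; case: (lerP x 0) => h; [right|left]; rewrite ?(ltW h). Qed.

(** One step of the supermartingale argument: an increment [y] of nonpositive mean raises the
    expected squared positive part by at most its second moment. *)
Lemma pos_sqrD x y : pos (x + y) ^+ 2 <= pos x ^+ 2 + 2 * pos x * y + y ^+ 2.
Proof.
have h := le_pos x; have h0 := pos_ge0 x.
have -> : pos x ^+ 2 + 2 * pos x * y + y ^+ 2 = (pos x + y) ^+ 2 by ring.
case: (posE (x + y)) => -[-> h1]; last by rewrite expr0n/= sqr_ge0.
by rewrite lerXn2r ?nnegrE//; lra.
Qed.

Lemma sqrD_le x y : (x + y) ^+ 2 <= 2 * (x ^+ 2 + y ^+ 2).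
Proof. by have := sqr_ge0 (x - y); lra. Qed.

Lemma sqr_posE x : x ^+ 2 = pos x ^+ 2 + pos (- x) ^+ 2.
Proof.
have [h|h] := lerP x 0.
  by rewrite /pos max_r// max_l ?oppr_ge0// expr0n/= sqrrN add0r.
by rewrite /pos max_l ?ltW// max_r ?oppr_le0 ?ltW// expr0n/= addr0.
Qed.

(* For [v = 0] this relies on [ln 0 = 0]. *)
Lemma mulr_ln_ge v u : 0 <= v -> 0 <= u -> (0 < v -> 0 < u) ->
  v - u <= v * ln (v / u).
Proof.
rewrite le_eqVlt => /predU1P[<- u0 _|v0 _ /(_ v0) u0]; first by rewrite mul0r; lra.
have q0 : 0 < u / v by rewrite divr_gt0.
have := ler_wpM2l (ltW v0) (ln_le_subr1 q0).
rewrite !ln_div ?posrE// [_ * (u / v - 1)]mulrBr mulr1 [v * (u / v)]mulrC.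
by rewrite divfK ?lt0r_neq0// => h; lra.
Qed.

(** With [y = x / 4], the exponential is at least [(1 + y)^4], and [(1 + y)^2 >= 4 y]. *)
Lemma sqr_le_expR x : 0 <= x -> x ^+ 2 <= expR x.
Proof.
move=> x0; have -> : x = (x / 4) *+ 4 by rewrite -mulr_natr; field.
rewrite -[(x/4) *+ 4]mulr_natr expRM_natr.
have := expR_ge1Dx (x / 4); set y := x / 4; have y0 : 0 <= y by rewrite /y; lra.
move=> h; have h2 : (1 + y) ^+ 4 <= expR y ^+ 4 by rewrite lerXn2r ?nnegrE ?expR_ge0//; lra.
apply: le_trans h2; have : 0 <= (1 + y) ^+ 2 - 4 * y.
  have -> : (1 + y) ^+ 2 - 4 * y = (1 - y) ^+ 2 by ring.
  exact: sqr_ge0.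
move=> h3; have -> : (y * 4) ^+ 2 = (4 * y) ^+ 2 by ring.
have -> : (1 + y) ^+ 4 = ((1 + y) ^+ 2) ^+ 2 by rewrite -exprM.
by rewrite lerXn2r ?nnegrE; nra.
Qed.

(** Apply [sqr_le_expR] to [ln (u / v)] when it is nonnegative. After summation, the downward part
    of any log-likelihood ratio has second moment at most 1, whatever the two laws. *)
Lemma mulr_neg_ln_sqr v u : 0 <= v -> 0 <= u -> (0 < v -> 0 < u) ->
  v * pos (- ln (v / u)) ^+ 2 <= u.
Proof.
rewrite le_eqVlt => /predU1P[<- u0 _|v0 _ /(_ v0) u0]; first by rewrite mul0r.
have q0 : 0 < u / v by rewrite divr_gt0.
have := sqr_le_expR (pos_ge0 (- ln (v / u))).
move=> h; rewrite mulrC -ler_pdivlMr//.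
case: (posE (- ln (v / u))) => -[e h1]; rewrite e in h *.
  by apply: le_trans h _; rewrite -lnV ?posrE ?divr_gt0// invf_div lnK ?posrE.
by rewrite expr0n/= ltW.
Qed.

(** Both [x ln (x / u)] and [x pos (ln (x / u))^2] are convex in [x]. Each is bounded below by its
    tangent at the mixture [v]. *)
Lemma logsum a v1 v2 u (l := 1 - a) (v := a * v1 + l * v2) : 0 <= a <= 1 ->
  0 <= v1 -> 0 <= v2 -> 0 <= u -> (0 < v1 -> 0 < u) -> (0 < v2 -> 0 < u) ->
  v * ln (v / u) <= a * (v1 * ln (v1 / u)) + l * (v2 * ln (v2 / u)) /\
  v * pos (ln (v / u)) ^+ 2 <=
   a * (v1 * pos (ln (v1 / u)) ^+ 2) + l * (v2 * pos (ln (v2 / u)) ^+ 2).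
Proof.
move=> /andP[a0 a1] p1 p2 u0 h1 h2; have l0 : 0 <= l by rewrite /l; lra.
have v0 : 0 <= v by rewrite addr_ge0// mulr_ge0.
(* The two tangent inequalities at [v], evaluated at [w] and weighted by [b]. The terms in [w - v]
   cancel when the two weighted instances are added. *)
have key w b : 0 <= b -> 0 <= w -> (0 < w -> 0 < u) -> (0 < b * w -> 0 < v) ->
  b * (w - v) <= b * (w * ln (w / u)) - b * (w * ln (v / u)) /\
  b * (w * pos (ln (v / u)) ^+ 2) + 2 * pos (ln (v / u)) * (b * (w - v)) <=
   b * (w * pos (ln (w / u)) ^+ 2).
  rewrite le_eqVlt => /predU1P[<- *|b0]; first by rewrite !mul0r subr0 mulr0 addr0.
  rewrite le_eqVlt => /predU1P[<- _ _|w0].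
    rewrite !(mul0r, mulr0) subr0 sub0r; have h := pos_ge0 (ln (v / u)).
    have bv := mulr_ge0 (ltW b0) v0; have := mulr_ge0 h bv.
    by split; lra.
  move=> /(_ w0) u1; rewrite mulr_gt0// => /(_ isT) vp.
  have := @mulr_ln_ge w v (ltW w0) (ltW vp) (fun=> vp).
  rewrite !ln_div ?posrE// => h.
  split; first by rewrite -!mulrBr ler_pM2l//; lra.
  set z := ln v - ln u; set x := ln w - ln u.
  have px := le_pos x; have := pos_ge0 z => pz.
  have pzz : (pos z = z \/ pos z = 0) by case: (posE z) => -[-> _]; [left|right].
  suff h5 : w * pos z ^+ 2 + 2 * pos z * (w - v) <= w * pos x ^+ 2.
    by have := ler_wpM2l (ltW b0) h5; lra.
  have h3 : w - v <= w * (x - z) by rewrite /x /z; lra.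
  have h4 : pos z * (w - v) <= pos z * (w * (pos x - pos z)).
    case: pzz => pzz; last by rewrite pzz !mul0r.
    rewrite pzz; rewrite pzz in pz; apply: ler_wpM2l => //.
    by apply: le_trans h3 _; apply: ler_wpM2l; [exact: ltW|lra].
  have : 0 <= w * (pos x - pos z) ^+ 2 by rewrite mulr_ge0 ?sqr_ge0// ltW.
  lra.
have [|k1 k1'] := key v1 a a0 p1 h1.
  by rewrite /v => h; have := mulr_ge0 l0 p2; lra.
have [|k2 k2'] := key v2 l l0 p2 h2.
  by rewrite /v => h; have := mulr_ge0 a0 p1; lra.
have e : a * (v1 - v) + l * (v2 - v) = 0 by rewrite /v /l; ring.
split.
  have -> : v * ln (v / u) = a * (v1 * ln (v / u)) + l * (v2 * ln (v / u)).
    by rewrite {1}/v; ring.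
  lra.
set z := pos (ln (v / u)) in k1' k2' *.
have -> : v * z ^+ 2 = a * (v1 * z ^+ 2) + l * (v2 * z ^+ 2) by rewrite /v; ring.
have : 2 * z * (a * (v1 - v)) + 2 * z * (l * (v2 - v)) = 0 by rewrite -mulrDr e mulr0.
lra.
Qed.

End RealInequalities.

(** * Changes of measure on one block and their composition *)

Section OneShot.
Context {R : realType} {T : finType}.
Implicit Types (P : pred T) (v w q u : T -> R).

(** The predicate [P] will be a cylinder fixing the past, so that [v] is a conditional law on it. *)
Definition isprob P v := (forall y, P y -> 0 <= v y) /\ \sum_(y | P y) v y = 1.
Definition abscont P v u := forall y, P y -> 0 < v y -> 0 < u y.
Definition kl P v u := \sum_(y | P y) v y * ln (v y / u y).
(** The negative part needs no record, being controlled by [mulr_neg_ln_sqr]. *)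
Definition pos2 P v u := \sum_(y | P y) v y * pos (ln (v y / u y)) ^+ 2.

Lemma kl_ge0 P v u : isprob P v -> isprob P u -> abscont P v u -> 0 <= kl P v u.
Proof.
move=> [v0 v1] [u0 u1] vu; have <- : \sum_(y | P y) (v y - u y) = 0.
  by rewrite sumrB v1 u1 subrr.
by apply: ler_sum => y Py; apply: mulr_ln_ge; [exact: v0|exact: u0|exact: vu].
Qed.

(** The law [v] is [w^b q^(1-b)] normalized, and [d] is the Renyi divergence of order [b] of [w]
    from [q]. Pointwise [ln (v / w) = th (d - ln (v / q))]: the upward part of one ratio is the
    downward part of the other, hence the second moments are bounded by [mulr_neg_ln_sqr]. *)
Lemma tilt P w q (b c : R) (th := (1 - b) / b) : isprob P w -> isprob P q ->
  0 < b < 1 ->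
  expR (- ((1 - b) * c)) <= \sum_(y | P y) w y `^ b * q y `^ (1 - b) ->
  exists v d, [/\ isprob P v, abscont P v w, abscont P v q, 0 <= d <= c &
   [/\ kl P v w = th * (d - kl P v q),
      pos2 P v w <= 2 * th ^+ 2 * (d ^+ 2 + 1) &
      pos2 P v q <= 2 * (d ^+ 2 + th ^- 2)]].
Proof.
move=> [w0 w1] [q0 q1] b01; have [b0 b1] := andP b01.
set Z := \sum_(y | P y) _ => hZ.
have Z0 : 0 < Z by apply: lt_le_trans hZ; exact: expR_gt0.
have Z1 : Z <= 1.
  rewrite (_ : 1 = \sum_(y | P y) (b * w y + (1 - b) * q y)).
    by apply: ler_sum => y Py; apply: young; rewrite ?w0 ?q0.
  by rewrite big_split/= -!mulr_sumr w1 q1; lra.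
have th0 : 0 < th by rewrite /th divr_gt0//; lra.
set d := - ln Z / (1 - b).
have d0 : 0 <= d by rewrite /d divr_ge0 ?oppr_ge0 ?ln_le0//; lra.
have dc : d <= c.
  rewrite /d ler_pdivrMr; last lra.
  by move: hZ; rewrite -ler_ln ?posrE ?expR_gt0// expRK; lra.
set v := fun y => w y `^ b * q y `^ (1 - b) / Z.
have v0 y : 0 <= v y by rewrite !mulr_ge0 ?powR_ge0// invr_ge0 ltW.
have v1 : \sum_(y | P y) v y = 1 by rewrite -mulr_suml divff ?lt0r_neq0.
have vwq y : P y -> 0 < v y -> 0 < w y /\ 0 < q y.
  move=> Py; rewrite lt0r => /andP[].
  rewrite !mulf_eq0 !negb_or => /andP[/andP[wb qb] _] _.
  split; rewrite lt0r ?w0 ?q0// andbT; [apply: contraNneq wb|apply: contraNneq qb] => ->;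
    by rewrite powR0 // lt0r_neq0//; lra.
have vE y : P y -> 0 < v y -> ln (v y) = b * ln (w y) + (1 - b) * ln (q y) - ln Z.
  move=> Py vy; have [wy qy] := vwq y Py vy.
  by rewrite /v ln_div ?posrE ?mulr_gt0 ?powR_gt0// lnM ?posrE ?powR_gt0// !ln_powR.
clearbody v.
have lvE y : P y -> 0 < v y ->
    ln (v y / w y) = th * (d - ln (v y / q y)) /\
    ln (v y / q y) = d - ln (v y / w y) / th.
  move=> Py vy; have [wy qy] := vwq y Py vy.
  rewrite !ln_div ?posrE// vE// /th /d; split; field; lra.
clearbody d th.
have v00 y : P y -> (v y = 0) \/ (0 < v y).
  by move=> Py; have := v0 y; rewrite le_eqVlt => /predU1P[<-|]; [left|right].
exists v, d; split.
- by split.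
- by move=> y Py /(vwq y Py) [].
- by move=> y Py /(vwq y Py) [].
- by rewrite d0.
split.
- rewrite mulrBr -[th * d]mulr1 -v1 /kl !mulr_sumr -sumrB; apply: eq_bigr => y Py.
  have [->|vy] := v00 y Py; first by rewrite !(mul0r, mulr0) subr0.
  have [-> _] := lvE y Py vy; ring.
- rewrite [leRHS](_ : _ = \sum_(y | P y) 2 * th ^+ 2 * (v y * d ^+ 2 + q y)).
    apply: ler_sum => y Py.
    have [->|vy] := v00 y Py.
      rewrite !mul0r add0r; have := mulr_ge0 (sqr_ge0 th) (q0 y Py); lra.
    have h := @mulr_neg_ln_sqr _ (v y) (q y) (v0 y) (q0 y Py) (fun h => (vwq y Py h).2).
    have [-> _] := lvE y Py vy; set L := ln (v y / q y) in h *.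
    have hp : pos (th * (d - L)) <= th * (d + pos (- L)).
      by apply: pos_le; [|rewrite ler_pM2l//]; have := pos_ge0 (- L); have := le_pos (- L); nra.
    have h2 : pos (th * (d - L)) ^+ 2 <= th ^+ 2 * (2 * (d ^+ 2 + pos (- L) ^+ 2)).
      apply: (@le_trans _ _ ((th * (d + pos (- L))) ^+ 2)).
        by rewrite lerXn2r ?nnegrE ?pos_ge0//; apply: le_trans hp; exact: pos_ge0.
      by rewrite exprMn ler_wpM2l ?sqr_ge0// sqrD_le.
    apply: (le_trans (ler_wpM2l (v0 y) h2)).
    have := ler_wpM2l (sqr_ge0 th) h; nra.
  by rewrite -mulr_sumr big_split/= -mulr_suml v1 q1 mul1r.
- rewrite [leRHS](_ : _ = \sum_(y | P y) 2 * (v y * d ^+ 2 + th ^- 2 * w y)).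
    apply: ler_sum => y Py.
    have [->|vy] := v00 y Py.
      rewrite !mul0r add0r; have t2 : 0 <= th ^- 2 by rewrite invr_ge0 sqr_ge0.
      have := mulr_ge0 t2 (w0 y Py); lra.
    have h := @mulr_neg_ln_sqr _ (v y) (w y) (v0 y) (w0 y Py) (fun h => (vwq y Py h).1).
    have [_ ->] := lvE y Py vy; set L := ln (v y / w y) in h *.
    have t0 : 0 <= th^-1 by rewrite invr_ge0 ltW.
    have hp : pos (d - L / th) <= d + th^-1 * pos (- L).
      apply: pos_le; first by rewrite addr_ge0// mulr_ge0// pos_ge0.
      by have := ler_wpM2l t0 (le_pos (- L)); lra.
    have h2 : pos (d - L / th) ^+ 2 <= 2 * (d ^+ 2 + th ^- 2 * pos (- L) ^+ 2).
      apply: (@le_trans _ _ ((d + th^-1 * pos (- L)) ^+ 2)).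
        by rewrite lerXn2r ?nnegrE ?pos_ge0//; apply: le_trans hp; exact: pos_ge0.
      by have := sqrD_le d (th^-1 * pos (- L)); rewrite exprMn exprVn.
    apply: (le_trans (ler_wpM2l (v0 y) h2)).
    have t2 : 0 <= th ^- 2 by rewrite invr_ge0 sqr_ge0.
    have := ler_wpM2l t2 h; lra.
  by rewrite -mulr_sumr big_split/= -mulr_suml -mulr_sumr v1 w1 mul1r mulr1.
Qed.

Lemma kl_mix P (a : R) v1 v2 u (v := fun y => a * v1 y + (1 - a) * v2 y) :
  0 <= a <= 1 -> isprob P v1 -> isprob P v2 -> (forall y, P y -> 0 <= u y) ->
  abscont P v1 u -> abscont P v2 u ->
  [/\ isprob P v, abscont P v u,
   kl P v u <= a * kl P v1 u + (1 - a) * kl P v2 u &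
   pos2 P v u <= a * pos2 P v1 u + (1 - a) * pos2 P v2 u].
Proof.
move=> a01 [p1 s1] [p2 s2] u0 ac1 ac2; have [a0 a1] := andP a01.
split.
- split=> [y Py|]; first by rewrite addr_ge0// mulr_ge0 ?p1 ?p2//; lra.
  by rewrite big_split/= -!mulr_sumr s1 s2; lra.
- move=> y Py; rewrite /v => vy.
  have := p1 y Py; rewrite le_eqVlt => /predU1P[e1|]; last exact: ac1.
  have := p2 y Py; rewrite le_eqVlt => /predU1P[e2|]; last exact: ac2.
  by move: vy; rewrite -e1 -e2 !mulr0 addr0 ltxx.
- rewrite /kl !mulr_sumr -big_split/=; apply: ler_sum => y Py.
  by have [] := @logsum _ a (v1 y) (v2 y) (u y) a01 (p1 _ Py) (p2 _ Py) (u0 _ Py)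
    (ac1 _ Py) (ac2 _ Py).
- rewrite /pos2 !mulr_sumr -big_split/=; apply: ler_sum => y Py.
  by have [] := @logsum _ a (v1 y) (v2 y) (u y) a01 (p1 _ Py) (p2 _ Py) (u0 _ Py)
    (ac1 _ Py) (ac2 _ Py).
Qed.

(** Serves to replace the output law of one order by the average over the grid, at the price of the
    logarithm of the grid size. *)
Lemma kl_dominate P v u u' (k : R) : isprob P v -> 1 <= k ->
  abscont P v u -> abscont P v u' -> (forall y, P y -> u y <= k * u' y) ->
  kl P v u' <= kl P v u + ln k /\ pos2 P v u' <= 2 * (pos2 P v u + ln k ^+ 2).
Proof.
move=> [v0 v1] k1 vu vu' uu'; have k0 : 0 < k by lra.
have lk : 0 <= ln k by rewrite ln_ge0.
have h y : P y -> 0 < v y -> ln (v y / u' y) <= ln (v y / u y) + ln k.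
  move=> Py vy; have uy := vu _ Py vy; have uy' := vu' _ Py vy.
  have := uu' _ Py; rewrite -ler_ln ?posrE ?mulr_gt0// lnM ?posrE//.
  by rewrite !ln_div ?posrE//; lra.
have v00 y : P y -> (v y = 0) \/ (0 < v y).
  by move=> Py; have := v0 y Py; rewrite le_eqVlt => /predU1P[<-|]; [left|right].
split.
  rewrite -[ln k]mul1r -v1 /kl mulr_suml -big_split/=; apply: ler_sum => y Py.
  have [->|vy] := v00 y Py; first by rewrite !mul0r addr0.
  by rewrite -mulrDr ler_pM2l// h.
rewrite (_ : ln k ^+ 2 = \sum_(y | P y) v y * ln k ^+ 2); last first.
  by rewrite -mulr_suml v1 mul1r.
rewrite /pos2 -big_split/= mulr_sumr.
apply: ler_sum => y Py.
have [->|vy] := v00 y Py; first by rewrite !mul0r addr0 mulr0.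
rewrite -mulrDr [leRHS]mulrCA ler_pM2l//.
apply: (@le_trans _ _ ((pos (ln (v y / u y)) + ln k) ^+ 2)); last exact: sqrD_le.
rewrite lerXn2r ?nnegrE ?pos_ge0 ?addr_ge0 ?pos_ge0//.
apply: pos_le; first by rewrite addr_ge0 ?pos_ge0.
by have := h y Py vy; have := le_pos (ln (v y / u y)); lra.
Qed.

(* [attain P w q E rho s]: a change of measure [v] on the cylinder [P] whose
   log-likelihood ratios to [w] and [q] exceed [E] and [rho] only by
   supermartingale-like fluctuations of variance [s].  Quantifying over the
   starting value [t] is what makes the property compose along blocks. *)
Definition attain P w q (E rho s : R) : Prop :=
  exists v, [/\ isprob P v, abscont P v w, abscont P v q,
   forall t, \sum_(y | P y) v y * pos (t + (ln (v y / w y) - E)) ^+ 2 <= pos t ^+ 2 + s &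
   forall t, \sum_(y | P y) v y * pos (t + (ln (v y / q y) - rho)) ^+ 2 <= pos t ^+ 2 + s].

(** Expand with [pos_sqrD]: the linear term has mean [kl P v u - E <= 0], and the square splits into
    the upward part [pos2] and a downward part of mass at most 1. *)
Lemma fluct P v u (E s : R) : isprob P v -> isprob P u -> abscont P v u ->
  kl P v u <= E -> 2 * (pos2 P v u + 1) + 2 * E ^+ 2 <= s ->
  forall t, \sum_(y | P y) v y * pos (t + (ln (v y / u y) - E)) ^+ 2 <= pos t ^+ 2 + s.
Proof.
move=> [v0 v1] [u0 u1] vu klE hs t.
apply: (@le_trans _ _ (\sum_(y | P y) (v y * pos t ^+ 2 + 2 * pos t * (v y * ln (v y / u y) - v y * E)
   + (2 * (v y * pos (ln (v y / u y)) ^+ 2 + u y) + v y * (2 * E ^+ 2))))).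
  apply: ler_sum => y Py.
  have h := @mulr_neg_ln_sqr _ (v y) (u y) (v0 y Py) (u0 y Py) (vu y Py).
  apply: le_trans (ler_wpM2l (v0 y Py) (pos_sqrD _ _)) _.
  set L := ln (v y / u y) in h *.
  have := ler_wpM2l (v0 y Py) (sqrD_le L (- E)); rewrite sqrrN (sqr_posE L); lra.
rewrite !big_split/= -!mulr_sumr big_split/= sumrN -!mulr_suml v1 !mul1r.
rewrite big_split/= u1.
have h := mulr_ge0 (ltac:(lra) : 0 <= 2 :> R) (pos_ge0 t).
move: klE hs; rewrite /kl /pos2 => klE hs.
have : 2 * pos t * (kl P v u - E) <= 0 by rewrite mulr_ge0_le0//; rewrite /kl; lra.
rewrite /kl; lra.
Qed.

Lemma grid_cross (a : nat -> R) (r : R) N : a 0%N <= r -> r < a N ->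
  exists2 j, (j < N)%N & a j <= r < a j.+1.
Proof.
elim: N => [|N IH] a0 aN; first by lra.
have [h|h] := lerP (a N) r; first by exists N => //; rewrite h.
by have [j jN hj] := IH a0 h; exists j => //; rewrite ltnS ltnW.
Qed.

(* The two neighbouring tilted laws at which the divergence to [q] crosses [r]
   are mixed so that it equals [r] exactly; no continuity in the order is needed. *)
Lemma attain_block P w (q : nat -> T -> R) (b c : nat -> R) (N : nat)
   (E r D th H s : R) (t := fun j => (1 - b j) / b j)
   (qb := fun y => N.+1%:R^-1 * \sum_(j < N.+1) q j y) :
  isprob P w -> (forall j, isprob P (q j)) -> (forall j, 0 < b j < 1) ->
  (forall j, (j <= N)%N ->
   expR (- ((1 - b j) * c j)) <= \sum_(y | P y) w y `^ b j * q j y `^ (1 - b j)) ->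
  (forall j, (j < N)%N -> t j.+1 <= t j) ->
  c 0%N <= r ->
  (forall j, (j < N)%N -> t j * (c j - r) <= E /\ t j * (c j.+1 - r) <= E) ->
  t N * c N <= E ->
  (forall j, (j <= N)%N -> [/\ c j <= D, t j <= th & (t j)^-1 <= H]) ->
  2 * (2 * th ^+ 2 * (D ^+ 2 + 1) + 1) + 2 * E ^+ 2 <= s ->
  2 * (2 * (2 * (D ^+ 2 + H ^+ 2) + ln N.+1%:R ^+ 2) + 1)
     + 2 * (r + ln N.+1%:R) ^+ 2 <= s ->
  attain P w qb E (r + ln N.+1%:R) s.
Proof.
move=> pw pq b01 hZ tmono c0r hE hEN hbd hs1 hs2.
have N0 : (0 : R) < N.+1%:R by rewrite ltr0n.
have t0 j : 0 < t j by have /andP[? ?] := b01 j; rewrite divr_gt0//; lra.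
have pqb : isprob P qb.
  split=> [y Py|]; first by rewrite mulr_ge0 ?invr_ge0// sumr_ge0// => j _; exact: (pq j).1.
  rewrite -mulr_sumr exchange_big/= (eq_bigr (fun=> 1)) => [|j _]; last exact: (pq j).2.
  by rewrite sumr_const card_ord mulVf ?lt0r_neq0.
have qqb j y : (j <= N)%N -> P y -> q j y <= N.+1%:R * qb y.
  move=> jN Py; rewrite mulrA mulfV ?lt0r_neq0// mul1r.
  rewrite (bigD1 (inord j : 'I_N.+1))//= inordK//.
  by rewrite lerDl sumr_ge0// => i _; exact: (pq i).1.
(* Beyond the grid, [w] is only a filler value. *)
have /choice[V hV] : forall j, exists v, (j <= N)%N -> exists d,
   [/\ isprob P v, abscont P v w, abscont P v (q j), 0 <= d <= c j &
   [/\ kl P v w = t j * (d - kl P v (q j)),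
      pos2 P v w <= 2 * (t j) ^+ 2 * (d ^+ 2 + 1) &
      pos2 P v (q j) <= 2 * (d ^+ 2 + (t j) ^- 2)]].
  move=> j; have [jN|jN] := leqP j N; last by exists w.
  by have [v hv] := tilt pw (pq j) (b01 j) (hZ j jN); exists v.
clearbody t qb.
have {}hV j : (j <= N)%N ->
   [/\ isprob P (V j), abscont P (V j) w, abscont P (V j) qb,
    kl P (V j) qb <= kl P (V j) (q j) + ln N.+1%:R &
   [/\ kl P (V j) w <= t j * (c j - kl P (V j) (q j)),
      kl P (V j) (q j) <= c j, kl P (V j) w <= t j * c j,
      pos2 P (V j) w <= 2 * th ^+ 2 * (D ^+ 2 + 1) &
      pos2 P (V j) qb <= 2 * (2 * (D ^+ 2 + H ^+ 2) + ln N.+1%:R ^+ 2)]].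
  move=> jN; have [d [pV Vw Vq /andP[d0 dc] [e1 e2 e3]]] := hV j jN.
  have [cD tth tH] := hbd j jN.
  have Vqb : abscont P (V j) qb.
    move=> y Py /(Vq y Py) h; have := lt_le_trans h (qqb j y jN Py).
    by rewrite pmulr_rgt0.
  have N1 : (1 : R) <= N.+1%:R by rewrite ler1n.
  have [k1 k2] := kl_dominate pV N1 Vq Vqb (fun y Py => qqb j y jN Py).
  have k3 := kl_ge0 pV (pq j) Vq.
  have k4 := kl_ge0 pV pw Vw.
  have dD : d ^+ 2 <= D ^+ 2 by rewrite lerXn2r ?nnegrE//; lra.
  have tt : t j ^+ 2 <= th ^+ 2 by rewrite lerXn2r ?nnegrE ?(ltW (t0 j))//; have := t0 j; lra.
  have HH : (t j) ^- 2 <= H ^+ 2.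
    rewrite -exprVn lerXn2r ?nnegrE ?invr_ge0 ?(ltW (t0 j))//.
    by apply: le_trans tH; rewrite invr_ge0 (ltW (t0 j)).
  split=> //; split.
  - by rewrite e1 ler_pM2l//; lra.
  - by apply: le_trans dc; rewrite -subr_ge0 -(pmulr_rge0 _ (t0 j)) -e1.
  - by rewrite e1 ler_pM2l//; lra.
  - apply: le_trans e2 _.
    have d1 : 0 <= d ^+ 2 + 1 by rewrite addr_ge0 ?sqr_ge0.
    have dD1 : d ^+ 2 + 1 <= D ^+ 2 + 1 by rewrite lerD2r.
    by have := ler_pM (sqr_ge0 (t j)) d1 tt dD1; lra.
  - by apply: le_trans k2 _; lra.
have done v : isprob P v -> abscont P v w -> abscont P v qb -> kl P v w <= E ->
    kl P v qb <= r + ln N.+1%:R ->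
    pos2 P v w <= 2 * th ^+ 2 * (D ^+ 2 + 1) ->
    pos2 P v qb <= 2 * (2 * (D ^+ 2 + H ^+ 2) + ln N.+1%:R ^+ 2) ->
    attain P w qb E (r + ln N.+1%:R) s.
  by move=> pv vw vq h1 h2 h3 h4; exists v; split=> //; apply: fluct => //; lra.
(* Without a crossing up to the last order, its tilted law works alone: its exponent is at most
   [t N * c N]. *)
have [aN|aN] := lerP (kl P (V N) (q N)) r.
  have [pV Vw Vq h1 [h2 h3 h4 h5 h6]] := hV N (leqnn N).
  by apply: (done (V N)) => //; lra.
have [|j jN /andP[aj aj1]] := @grid_cross (fun j => kl P (V j) (q j)) r N _ aN.
  by have [_ _ _ _ [_ h _ _ _]] := hV 0%N (leq0n N); lra.
have [pV Vw Vq h1 [h2 h3 h4 h5 h6]] := hV j (ltnW jN).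
have [pV' Vw' Vq' h1' [h2' h3' h4' h5' h6']] := hV j.+1 jN.
set A := kl P (V j) (q j) in aj h1 h2 h3; set A' := kl P (V j.+1) (q j.+1) in aj1 h1' h2' h3'.
have AA : 0 < A' - A by lra.
(* The weight solving [l A + (1 - l) A' = r]. *)
set l := (A' - r) / (A' - A).
have l01 : 0 <= l <= 1 by rewrite /l divr_ge0/= ?ler_pdivrMr//; lra.
have lE : l * A + (1 - l) * A' = r by rewrite /l; field; lra.
have [pv vw k1 k2] := kl_mix l01 pV pV' pw.1 Vw Vw'.
have [_ vq k1' k2'] := kl_mix l01 pV pV' pqb.1 Vq Vq'.
have [l0 l1] := andP l01; have l1' : 0 <= 1 - l by lra.
apply: done pv vw vq _ _ _ _.
- apply: le_trans k1 _.
  (* Both exponents get the same factor [t j], so that their mixture depends on [A] and [A'] only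
     through [r]. *)
  have g : kl P (V j.+1) w <= t j * (c j.+1 - A').
    by apply: le_trans h2' _; rewrite ler_wpM2r ?tmono// subr_ge0.
  have [E1 E2] := hE j jN.
  have := ler_wpM2l l0 h2; have := ler_wpM2l l1' g.
  have := ler_wpM2l l0 E1; have := ler_wpM2l l1' E2.
  have : t j * (l * A + (1 - l) * A') = t j * r by rewrite lE.
  lra.
- apply: le_trans k1' _; have := ler_wpM2l l0 h1; have := ler_wpM2l l1' h1'; lra.
- apply: le_trans k2 _; have := ler_wpM2l l0 h5; have := ler_wpM2l l1' h5'; lra.
- apply: le_trans k2' _; have := ler_wpM2l l0 h6; have := ler_wpM2l l1' h6'; lra.
Qed.

Lemma attain_le P w q E rho s E' rho' s' : E <= E' -> rho <= rho' -> s <= s' ->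
  attain P w q E rho s -> attain P w q E' rho' s'.
Proof.
move=> EE rr ss [v [[v0 v1] vw vq h1 h2]]; exists v; split=> // t.
- apply: le_trans (_ : pos t ^+ 2 + s <= _); last by rewrite lerD2l.
  apply: le_trans (h1 t); apply: ler_sum => y Py; apply: ler_wpM2l; first exact: v0.
  rewrite lerXn2r ?nnegrE ?pos_ge0//; apply: pos_le; first exact: pos_ge0.
  by apply: le_trans (le_pos _); lra.
- apply: le_trans (_ : pos t ^+ 2 + s <= _); last by rewrite lerD2l.
  apply: le_trans (h2 t); apply: ler_sum => y Py; apply: ler_wpM2l; first exact: v0.
  rewrite lerXn2r ?nnegrE ?pos_ge0//; apply: pos_le; first exact: pos_ge0.
  by apply: le_trans (le_pos _); lra.
Qed.

(** Chain the law on the first block with the conditional laws on the second, chosen for each past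
    [pi z]. Log-likelihood ratios add up, and so do exponents, rates and variances. *)
Lemma attain_chain P P1 (P2 : T -> pred T) (pi : T -> T)
   w w1 w2 q q1 q2 (E1 E2 r1 r2 s1 s2 : R) :
  (forall phi : T -> R, \sum_(z | P z) phi z = \sum_(y | P1 y) \sum_(z | P2 y z) phi z) ->
  (forall z, P z -> P1 (pi z) /\ P2 (pi z) z) ->
  (forall y z, P1 y -> P2 y z -> [/\ pi z = y, w z = w1 y * w2 z & q z = q1 y * q2 z]) ->
  attain P1 w1 q1 E1 r1 s1 ->
  (forall y, P1 y -> attain (P2 y) w2 q2 E2 r2 s2) ->
  attain P w q (E1 + E2) (r1 + r2) (s1 + s2).
Proof.
move=> part hpi hw [v1 [[v10 v11] ac1 ac1' f1 f1']].
move=> h; have /choice[V hV] : forall y, exists v, P1 y ->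
  [/\ isprob (P2 y) v, abscont (P2 y) v w2, abscont (P2 y) v q2,
   forall t, \sum_(z | P2 y z) v z * pos (t + (ln (v z / w2 z) - E2)) ^+ 2 <= pos t ^+ 2 + s2 &
   forall t, \sum_(z | P2 y z) v z * pos (t + (ln (v z / q2 z) - r2)) ^+ 2 <= pos t ^+ 2 + s2].
  move=> y; have [Py|Py] := boolP (P1 y); last by exists v1.
  by have [v hv] := h y Py; exists v.
set v := fun z => v1 (pi z) * V (pi z) z.
have sumE (phi : T -> R) : \sum_(z | P z) v z * phi z =
    \sum_(y | P1 y) v1 y * \sum_(z | P2 y z) V y z * phi z.
  rewrite part; apply: eq_bigr => y Py; rewrite mulr_sumr; apply: eq_bigr => z Pz.
  by have [e _ _] := hw y z Py Pz; rewrite /v e mulrA.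
have vpos z : P z -> 0 < v z -> 0 < v1 (pi z) /\ 0 < V (pi z) z.
  move=> Pz; have [Py Pz2] := hpi z Pz; have [[V0 _] _ _ _ _] := hV _ Py.
  rewrite lt0r mulf_eq0 negb_or => /andP[/andP[n1 n2] _].
  by rewrite !lt0r n1 n2 V0// v10.
have main (u u1 u2 : T -> R) e1 e2 : (forall y z, P1 y -> P2 y z -> u z = u1 y * u2 z) ->
   abscont P1 v1 u1 -> (forall y, P1 y -> abscont (P2 y) (V y) u2) ->
   (forall t, \sum_(y | P1 y) v1 y * pos (t + (ln (v1 y / u1 y) - e1)) ^+ 2 <= pos t ^+ 2 + s1) ->
   (forall y, P1 y -> forall t,
     \sum_(z | P2 y z) V y z * pos (t + (ln (V y z / u2 z) - e2)) ^+ 2 <= pos t ^+ 2 + s2) ->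
   forall t, \sum_(z | P z) v z * pos (t + (ln (v z / u z) - (e1 + e2))) ^+ 2
     <= pos t ^+ 2 + (s1 + s2).
  move=> uE a1 a2 g1 g2 t; rewrite sumE.
  (* The second block starts from the deviation accumulated in the first. *)
  apply: (@le_trans _ _ (\sum_(y | P1 y) v1 y * (pos (t + (ln (v1 y / u1 y) - e1)) ^+ 2 + s2))).
    apply: ler_sum => y Py.
    have := v10 y Py; rewrite le_eqVlt => /predU1P[<-|v1y]; first by rewrite !mul0r.
    rewrite ler_pM2l//; apply: le_trans (g2 y Py _).
    apply: ler_sum => z Pz; have [e _ _] := hw y z Py Pz.
    have [[V0 _] _ _ _ _] := hV _ Py.
    have := V0 z Pz; rewrite le_eqVlt => /predU1P[<-|Vz]; first by rewrite !mul0r.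
    rewrite ler_pM2l// (uE y z)// /v e.
    have u1y := a1 y Py v1y; have u2z := a2 y Py z Pz Vz.
    rewrite !ln_div ?posrE ?mulr_gt0// !lnM ?posrE//.
    by rewrite (_ : forall a b, a = b -> a ^+ 2 <= b ^+ 2)//; [move=> a b ->|congr pos; ring].
  under eq_bigr do rewrite mulrDr.
  by rewrite big_split/= -mulr_suml v11 mul1r addrA lerD2r.
exists v; split.
- split=> [z Pz|].
    have [Py Pz2] := hpi z Pz; have [[V0 _] _ _ _ _] := hV _ Py.
    by rewrite mulr_ge0 ?v10 ?V0.
  have := sumE (fun=> 1); under eq_bigr do rewrite mulr1; move=> ->.
  rewrite -[RHS]v11; apply: eq_bigr => y Py; have [[_ V1] _ _ _ _] := hV _ Py.
  by under eq_bigr do rewrite mulr1; rewrite V1 mulr1.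
- move=> z Pz /(vpos z Pz) [h1 h2]; have [Py Pz2] := hpi z Pz.
  have [_ -> _] := hw _ _ Py Pz2; have [_ a2 _ _ _] := hV _ Py.
  by rewrite mulr_gt0 ?(ac1 _ Py)// (a2 _ Pz2).
- move=> z Pz /(vpos z Pz) [h1 h2]; have [Py Pz2] := hpi z Pz.
  have [_ _ ->] := hw _ _ Py Pz2; have [_ _ a2 _ _] := hV _ Py.
  by rewrite mulr_gt0 ?(ac1' _ Py)// (a2 _ Pz2).
- apply: (main _ w1 w2) => //; first by move=> y z Py Pz; have [] := hw _ _ Py Pz.
    by move=> y Py; have [] := hV _ Py.
  by move=> y Py; have [] := hV _ Py.
- apply: (main _ q1 q2) => //; first by move=> y z Py Pz; have [] := hw _ _ Py Pz.
    by move=> y Py; have [] := hV _ Py.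
  by move=> y Py; have [] := hV _ Py.
Qed.

(** By Chebyshev each ratio exceeds its level by [tau] with [v]-probability at most 1/8. Elsewhere
    [v] is dominated by a multiple of [q], used on the decoding region [D], and by a multiple of
    [w], used off [D]. *)
Lemma attain_converse w q (E rho s tau : R) (D : pred T) :
  attain predT w q E rho s -> (forall y, 0 <= w y) -> (forall y, 0 <= q y) ->
  0 < tau -> 8 * s <= tau ^+ 2 ->
  3 / 4 <= expR (E + tau) * \sum_(y | ~~ D y) w y + expR (rho + tau) * \sum_(y | D y) q y.
Proof.
move=> [v [[v0 v1] vw vq f1 f2]] w0 q0 tau0 hs.
have T2 : 0 < tau ^+ 2 by rewrite exprn_gt0.
have small (u : T -> R) e : abscont predT v u ->
   (\sum_y v y * pos (0 + (ln (v y / u y) - e)) ^+ 2 <= pos 0 ^+ 2 + s) ->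
   \sum_y v y * pos (ln (v y / u y) - e) ^+ 2 / tau ^+ 2 <= 1 / 8.
  move=> vu; rewrite /pos maxxx expr0n/= add0r => h.
  rewrite -mulr_suml ler_pdivrMr//; under eq_bigr do rewrite -[_ - _]add0r.
  lra.
have dich y (u : T -> R) e : abscont predT v u -> 0 <= u y ->
   v y <= v y * pos (ln (v y / u y) - e) ^+ 2 / tau ^+ 2 \/ v y <= expR (e + tau) * u y.
  move=> vu u0; have := v0 y isT; rewrite le_eqVlt => /predU1P[<-|vy].
    by left; rewrite !mul0r.
  have uy := vu y isT vy.
  have [h|h] := lerP (ln (v y / u y)) (e + tau).
    right; rewrite -ler_pdivrMr//.
    by rewrite -[X in X <= _]lnK ?posrE ?divr_gt0// ler_expR.
  left; rewrite ler_pdivlMr// ler_pM2l// lerXn2r ?nnegrE ?pos_ge0 ?(ltW tau0)//.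
  by apply: le_trans (le_pos _); lra.
have sp y (u : T -> R) e : 0 <= v y * pos (ln (v y / u y) - e) ^+ 2 / tau ^+ 2.
  apply: mulr_ge0; last by rewrite invr_ge0 ltW.
  by apply: mulr_ge0; [exact: v0|exact: sqr_ge0].
have key : \sum_y v y <= \sum_y (v y * pos (ln (v y / w y) - E) ^+ 2 / tau ^+ 2 +
   v y * pos (ln (v y / q y) - rho) ^+ 2 / tau ^+ 2 +
   (if D y then expR (rho + tau) * q y else expR (E + tau) * w y)).
  apply: ler_sum => y _; have e0 x : 0 <= expR x :> R by exact: expR_ge0.
  have h1 := sp y w E; have h2 := sp y q rho.
  have h3 := mulr_ge0 (e0 (rho + tau)) (q0 y); have h4 := mulr_ge0 (e0 (E + tau)) (w0 y).
  case: (D y).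
    by case: (dich y q rho vq (q0 y)) => h; lra.
  by case: (dich y w E vw (w0 y)) => h; lra.
rewrite v1 !big_split/= in key.
have := small w E vw (f1 0); have := small q rho vq (f2 0).
move: key; rewrite [X in _ + _ + X](bigID D)/= !mulr_sumr.
rewrite [X in _ + (X + _)](eq_bigr (fun y => expR (rho + tau) * q y)) => [|y ->//].
rewrite [X in _ + (_ + X)](eq_bigr (fun y => expR (E + tau) * w y)) => [|y /negbTE->//].
lra.
Qed.

End OneShot.

(** * Causal laws on sequences *)

Section Cylinders.
Context {R : realType} {n : nat} {Y : 'I_n -> finType}.
Notation Omega := {dffun forall i : 'I_n, Y i}.
Implicit Types (y z : Omega) (s : nat).

(** Coordinates after the window are frozen as well as those before it, so a sum over the cylinder
    runs exactly over the letters of the window. *)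
Definition blk s s' y z := [forall i : 'I_n, ~~ (s <= i < s')%N ==> (z i == y i)].

Lemma blkP s s' y z :
  reflect (forall i : 'I_n, ~~ (s <= i < s')%N -> z i = y i) (blk s s' y z).
Proof.
by apply: (iffP forallP) => h i; [move=> hi; apply/eqP; move/implyP: (h i); apply|
  apply/implyP => hi; apply/eqP; exact: h].
Qed.

(** The projection [pi] of [attain_chain]: it keeps the past of [z] and resets the rest to [y]. *)
Definition glue s z y : Omega := [ffun i : 'I_n => if (i < s)%N then z i else y i].

Lemma glue_blk s s' s'' y z : (s <= s' <= s'')%N -> blk s s'' y z ->
  blk s s' y (glue s' z y) /\ blk s' s'' (glue s' z y) z.
Proof.
move=> /andP[h1 h2] /blkP h; split; apply/blkP => i hi; rewrite /glue ffunE.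
  by case: ltnP => // h3; apply: h; lia.
by case: ltnP => // h3; apply: h; lia.
Qed.

Lemma glue_eq s s' s'' y y' z : blk s s' y y' -> blk s' s'' y' z -> glue s' z y = y'.
Proof.
move=> /blkP h1 /blkP h2; apply/ffunP => i; rewrite /glue ffunE.
by case: ltnP => h3; [apply: h2|symmetry; apply: h1]; lia.
Qed.

Lemma blk_part s s' s'' y (phi : Omega -> R) : (s <= s' <= s'')%N ->
  \sum_(z | blk s s'' y z) phi z =
  \sum_(y' | blk s s' y y') \sum_(z | blk s' s'' y' z) phi z.
Proof.
move=> h; rewrite (partition_big (fun z => glue s' z y) (blk s s' y)) /=; last first.
  by move=> z /(glue_blk h) [].
apply: eq_bigr => y' hy'; apply: eq_bigl => z.
apply/andP/idP => [[h1 /eqP<-]|h1]; first by have [] := glue_blk h h1.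
split; last by apply/eqP; exact: glue_eq hy' h1.
move/blkP: hy' => hy'; move/blkP: h1 => h1; apply/blkP => i hi.
by rewrite h1 ?hy'//; lia.
Qed.

Lemma blk0 s y z : blk s s y z = (z == y).
Proof.
apply/blkP/eqP => [h|-> //]; apply/ffunP => i; apply: h; lia.
Qed.

Lemma sum_blk_letter (i : 'I_n) y (h : Y i -> R) :
  \sum_(z | blk i i.+1 y z) h (z i) = \sum_(u : Y i) h u.
Proof.
pose up u : Omega := [ffun j => @eqtype.dfwith _ _ y i u j].
have upi u : up u i = u by rewrite /up ffunE eqtype.dfwith_in.
rewrite (reindex_onto up (fun z => z i)) /=; last first.
  move=> z /blkP hz; apply/ffunP => j; rewrite /up ffunE.
  case: eqtype.dfwithP => [//|k ik]; symmetry; apply: hz.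
  by apply: contra ik => hk; apply/eqP/val_inj => /=; lia.
apply: eq_big => [u|u _]; last by rewrite upi.
rewrite upi eqxx andbT; apply/blkP => j hj; rewrite /up ffunE eqtype.dfwith_out//.
by apply: contraNneq hj => ->; lia.
Qed.

(** The shape of a feedback kernel: [k i] sees letter [i] and the letters before it. *)
Definition causal (k : 'I_n -> Omega -> R) :=
  forall (i : 'I_n) y z, (forall j : 'I_n, (j <= i)%N -> y j = z j) -> k i y = k i z.

Definition lprod (k : 'I_n -> Omega -> R) s s' z := \prod_(i < n | (s <= i < s')%N) k i z.

Lemma lprod_causal k s s' s'' y z : causal k -> blk s' s'' y z ->
  lprod k s s' z = lprod k s s' y.
Proof.
move=> ck /blkP h; apply: eq_bigr => i hi; apply: ck => j ji; apply: h; lia.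
Qed.

Lemma prod_split (k : 'I_n -> R) s s' s'' : (s <= s' <= s'')%N ->
  \prod_(i < n | (s <= i < s'')%N) k i =
  (\prod_(i < n | (s <= i < s')%N) k i) * \prod_(i < n | (s' <= i < s'')%N) k i.
Proof.
move=> h; rewrite (bigID (fun i : 'I_n => (i < s')%N)) /=; congr (_ * _);
 apply: eq_bigl => i; lia.
Qed.

Lemma prod_single (k : 'I_n -> R) (i : 'I_n) :
  \prod_(j < n | (i <= j < i.+1)%N) k j = k i.
Proof.
rewrite (big_pred1 i)// => j /=.
by apply/idP/eqP => [h|->]; [apply: val_inj => /=|]; lia.
Qed.

Lemma lprod_step k s (i : 'I_n) y : causal k -> (s <= i)%N ->
  \sum_(z | blk s i.+1 y z) lprod k s i.+1 z =
  \sum_(y' | blk s i y y') lprod k s i y' * \sum_(z | blk i i.+1 y' z) k i z.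
Proof.
move=> ck si; rewrite (@blk_part s i) ?si ?leqnSn//; apply: eq_bigr => y' _.
rewrite mulr_sumr; apply: eq_bigr => z hz.
rewrite /lprod (@prod_split _ s i) ?si ?leqnSn// prod_single; congr (_ * _).
exact: lprod_causal ck hz.
Qed.

(** Sum out the last letter first: whatever the past, its factor contributes at least [m i]. With
    [w^b q^(1-b)] as kernel this is the chain rule for Renyi divergence under feedback. *)
Lemma lprod_ge k (m : 'I_n -> R) s s' y : causal k -> (s <= s' <= n)%N ->
  (forall i z, 0 <= k i z) -> (forall i, 0 <= m i) ->
  (forall (i : 'I_n) z, m i <= \sum_(z' | blk i i.+1 z z') k i z') ->
  \prod_(i < n | (s <= i < s')%N) m i <= \sum_(z | blk s s' y z) lprod k s s' z.
Proof.
move=> ck; elim: s' => [|s' IH] /andP[ss' s'n] k0 m0 hm.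
  move: ss'; rewrite leqn0 => /eqP ->.
  rewrite (big_pred1 y) => [|z]; last by rewrite /= blk0.
  by rewrite /lprod !big_pred0// => i; lia.
move: ss'; rewrite leq_eqVlt => /predU1P[->|ss'].
  rewrite (big_pred1 y) => [|z]; last by rewrite /= blk0.
  by rewrite /lprod !big_pred0// => i; lia.
pose i := Ordinal s'n.
rewrite (@lprod_step k s i y ck ss') (@prod_split _ s i) /= ?leqnSn ?andbT//.
rewrite (prod_single m i).
apply: (@le_trans _ _ (\sum_(y' | blk s i y y') lprod k s i y' * m i)).
  rewrite -mulr_suml ler_wpM2r//; apply: IH => //; rewrite -ltnS ss' ltnW//.
by apply: ler_sum => y' _; rewrite ler_wpM2l// prodr_ge0.
Qed.

Lemma lprod_sum k (m : 'I_n -> R) s s' y : causal k -> (s <= s' <= n)%N ->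
  (forall (i : 'I_n) z, \sum_(z' | blk i i.+1 z z') k i z' = m i) ->
  \sum_(z | blk s s' y z) lprod k s s' z = \prod_(i < n | (s <= i < s')%N) m i.
Proof.
move=> ck; elim: s' => [|s' IH] /andP[ss' s'n] hm.
  move: ss'; rewrite leqn0 => /eqP ->.
  rewrite (big_pred1 y) => [|z]; last by rewrite /= blk0.
  by rewrite /lprod !big_pred0// => i; lia.
move: ss'; rewrite leq_eqVlt => /predU1P[->|ss'].
  rewrite (big_pred1 y) => [|z]; last by rewrite /= blk0.
  by rewrite /lprod !big_pred0// => i; lia.
pose i := Ordinal s'n.
rewrite (@lprod_step k s i y ck ss'); under eq_bigr do rewrite hm.
rewrite (@prod_split _ s i) /= ?leqnSn ?andbT// (prod_single m i).
by rewrite -mulr_suml IH//; rewrite -ltnS ss' ltnW.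
Qed.

Lemma lprod_sum1 k s s' y : causal k -> (s <= s' <= n)%N ->
  (forall (i : 'I_n) z, \sum_(z' | blk i i.+1 z z') k i z' = 1) ->
  \sum_(z | blk s s' y z) lprod k s s' z = 1.
Proof. by move=> ck h /(lprod_sum y ck h) ->; rewrite big1. Qed.

Lemma blk_full y z : blk 0 n y z.
Proof. by apply/blkP => i; rewrite ltn_ord. Qed.

Lemma lprod_full k z : lprod k 0 n z = \prod_(i < n) k i z.
Proof. by apply: eq_bigl => i; rewrite ltn_ord. Qed.

Lemma sum_prod_dffun y (h : forall i, Y i -> R) :
  \sum_(z : Omega) \prod_(i < n) h i (z i) = \prod_(i < n) \sum_(u : Y i) h i u.
Proof.
have c : causal (fun i z => h i (z i)) by move=> i y1 z1 ->.
have := @lprod_sum _ (fun i => \sum_(u : Y i) h i u) 0 n y c.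
rewrite leqnn => /(_ isT) e.
under eq_bigr do rewrite -(lprod_full (fun i z => h i (z i))).
rewrite -(eq_bigl _ _ (blk_full y)) e; first by apply: eq_bigl => i; rewrite ltn_ord.
by move=> i z; rewrite sum_blk_letter.
Qed.

Lemma powR_prod (I : finType) (P : pred I) (x : I -> R) a : (forall i, 0 <= x i) ->
  (\prod_(i | P i) x i) `^ a = \prod_(i | P i) x i `^ a.
Proof.
move=> x0; have [] : 0 <= \prod_(i | P i) x i /\
  (\prod_(i | P i) x i) `^ a = \prod_(i | P i) x i `^ a; last by [].
apply: (big_ind2 (fun u v => 0 <= u /\ u `^ a = v)).
- by rewrite powR1.
- by move=> u v u' v' [u0 <-] [u0' <-]; rewrite mulr_ge0// powRM.
- by move=> i _; rewrite x0.
Qed.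

(** * Concatenation of blocks along a feedback strategy *)

Section Tail.
Variables (N : nat) (b : nat -> R) (q : nat -> forall i : 'I_n, Y i -> R)
  (cc : nat -> 'I_n -> R).

(** What is retained of a feedback strategy: given any past, the next letter has Renyi divergence of
    order [b j] at most [cc j i] from the letter law [q j i]. *)
Definition steered (w : 'I_n -> Omega -> R) := [/\ causal w, (forall i z, 0 <= w i z),
  (forall (i : 'I_n) z, \sum_(z' | blk i i.+1 z z') w i z' = 1) &
  forall j (i : 'I_n) z, (j <= N)%N -> expR (- ((1 - b j) * cc j i)) <=
    \sum_(z' | blk i i.+1 z z') w i z' `^ b j * q j (z' i) `^ (1 - b j)].

(** Exponent [e] and rate [r] are per letter, the variance [S] is per block, and [c j m] bounds the
    sum of [cc j] over windows of length [m]. *)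
Variables (c : nat -> nat -> R) (l : nat) (D th H e r S : R).
Let t j := (1 - b j) / b j.
Hypothesis b01 : forall j, 0 < b j < 1.
Hypothesis q0 : forall j i (u : Y i), 0 <= q j u.
Hypothesis q1 : forall j i, \sum_(u : Y i) q j u = 1.
Hypothesis hcc : forall j s s', (j <= N)%N -> (s + l <= s')%N -> (s' < s + 2 * l)%N -> (s' <= n)%N ->
  \sum_(i < n | (s <= i < s')%N) cc j i <= c j (s' - s).
Hypothesis tmono : forall j, (j < N)%N -> t j.+1 <= t j.
Hypothesis l0 : (0 < l)%N.
Hypothesis S0 : 0 <= S.
Hypothesis hblock : forall m, (l <= m)%N -> (m < 2 * l)%N ->
  [/\ c 0%N m <= m%:R * r,
  (forall j, (j < N)%N -> t j * (c j m - m%:R * r) <= m%:R * e /\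
       t j * (c j.+1 m - m%:R * r) <= m%:R * e),
  t N * c N m <= m%:R * e,
  (forall j, (j <= N)%N -> [/\ c j m <= D, t j <= th & (t j)^-1 <= H]) &
  2 * (2 * th ^+ 2 * (D ^+ 2 + 1) + 1) + 2 * (m%:R * e) ^+ 2 <= S /\
  2 * (2 * (2 * (D ^+ 2 + H ^+ 2) + ln N.+1%:R ^+ 2) + 1)
     + 2 * (m%:R * r + ln N.+1%:R) ^+ 2 <= S].

Lemma steered_block (w : 'I_n -> Omega -> R) s s' y : steered w ->
  (s + l <= s')%N -> (s' < s + 2 * l)%N -> (s' <= n)%N ->
  attain (blk s s' y) (lprod w s s')
    (fun z => N.+1%:R^-1 * \sum_(j < N.+1) lprod (fun i z => q j (z i)) s s' z)
    ((s' - s)%:R * e) ((s' - s)%:R * r + ln N.+1%:R) S.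
Proof.
move=> [cw w0 w1 wq] h1 h2 h3.
have ss' : (s <= s' <= n)%N by lia.
have [||k1 k2 k3 k4 [k5 k6]] := hblock (m := s' - s); [lia|lia|].
have cq j : causal (fun i z => q j (z i)) by move=> i y1 z1 -> .
apply: (@attain_block R _ _ _ (fun j => lprod (fun i z => q j (z i)) s s') b
  (fun j => c j (s' - s)%N) N _ _ D th H) => //.
- by split=> [z _|]; [exact: prodr_ge0|exact: lprod_sum1].
- move=> j; split=> [z _|]; first by apply: prodr_ge0.
  by apply: lprod_sum1 => // i z; rewrite sum_blk_letter.
- move=> j jN; have b1 : 0 < 1 - b j by have := b01 j; lra.
  apply: (@le_trans _ _ (\prod_(i < n | (s <= i < s')%N) expR (- ((1 - b j) * cc j i)))).
    rewrite -expR_sum ler_expR sumrN -mulr_sumr lerN2 ler_pM2l//; exact: hcc.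
  rewrite [leRHS](_ : _ = \sum_(z | blk s s' y z)
     lprod (fun i z => w i z `^ b j * q j (z i) `^ (1 - b j)) s s' z); last first.
    by apply: eq_bigr => z _; rewrite /lprod !powR_prod// -big_split.
  apply: lprod_ge => //.
  + by move=> i y1 z1 h; rewrite (cw i y1 z1 h) (h i).
  + by move=> i z; rewrite mulr_ge0 ?powR_ge0.
  + by move=> i z; exact: wq.
Qed.

(** Induction on the remaining length, one block at a time. [Q] is chosen before [w], since one
    output law has to serve all messages. *)
Lemma steered_tail s : (s <= n)%N -> (n - s = 0 \/ l <= n - s)%N ->
  exists Q : Omega -> R, [/\ (forall z, 0 <= Q z),
    (forall y, \sum_(z | blk s n y z) Q z = 1) &
    forall w y, steered w -> attain (blk s n y) (lprod w s n) Q
      ((n - s)%:R * e) ((n - s)%:R * (r + ln N.+1%:R / l%:R)) ((n - s)%:R * (S / l%:R))].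
Proof.
have [d] := ubnP (n - s)%N; elim: d s => // d IH s hd sn [ns0|ns].
  have -> : s = n by lia.
  exists (fun=> 1); split=> // [y|w y _].
    by rewrite (big_pred1 y) // => z; rewrite /= blk0.
  exists (fun=> 1); rewrite subnn !mul0r.
  have B : blk n n y =1 pred1 y by move=> z; rewrite /= blk0.
  have wE z : lprod w n n z = 1 by rewrite /lprod big_pred0// => i; lia.
  split=> //; first by split=> //; rewrite (big_pred1 y).
  - by move=> z _ _; rewrite wE.
  - by move=> t'; rewrite (big_pred1 y)// wE divr1 ln1 subrr !addr0 mul1r.
  - by move=> t'; rewrite (big_pred1 y)// divr1 ln1 subrr !addr0 mul1r.
(* The last block absorbs the remainder, so no block is shorter than [l]. *)
pose m := if (n - s < 2 * l)%N then (n - s)%N else l.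
have [m1 m2 m3] : [/\ (l <= m)%N, (m < 2 * l)%N & (n - (s + m) = 0 \/ l <= n - (s + m))%N].
  by rewrite /m; case: ifP; split; lia.
have m4 : (s + m <= n)%N by rewrite /m; case: ifP; lia.
clearbody m.
have [|Q [Q0 Q1 hQ]] := IH (s + m)%N _ m4 m3; first by lia.
set qb := fun z => N.+1%:R^-1 * \sum_(j < N.+1) lprod (fun i z => q j (z i)) s (s + m) z.
have N0 : (0 : R) < N.+1%:R by rewrite ltr0n.
have L0 : (0 : R) < l%:R by rewrite ltr0n.
have cq j : causal (fun i z => q j (z i)) by move=> i y1 z1 -> .
have qbE y z : blk (s + m) n y z -> qb z = qb y.
  move=> h; congr (_ * _); apply: eq_bigr => j _; exact: lprod_causal (cq j) h.
have qb1 y : \sum_(z | blk s (s + m) y z) qb z = 1.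
  rewrite -mulr_sumr exchange_big/= (eq_bigr (fun=> 1)) => [|j _].
    by rewrite sumr_const card_ord mulVf ?lt0r_neq0.
  by apply: lprod_sum1 => // [|i z]; [lia|rewrite sum_blk_letter].
have ssn : (s <= s + m <= n)%N by lia.
exists (fun z => qb z * Q z); split.
- move=> z; rewrite mulr_ge0// mulr_ge0 ?invr_ge0 ?(ltW N0)//.
  by rewrite sumr_ge0// => j _; rewrite prodr_ge0.
- move=> y; rewrite (@blk_part s (s + m))// -[RHS](qb1 y); apply: eq_bigr => y' hy'.
  rewrite -[RHS]mulr1 -(Q1 y') mulr_sumr; apply: eq_bigr => z hz.
  by rewrite (qbE _ _ hz).
- move=> w y hw; have [cw _ _ _] := hw.
  have nE : (n - s)%:R = m%:R + (n - (s + m))%:R :> R by rewrite -natrD; congr (_%:R); lia.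
  rewrite nE !(mulrDl m%:R).
  apply: (@attain_chain R _ _ (blk s (s + m) y) (blk (s + m) n)
     (fun z => glue (s + m) z y) _ (lprod w s (s + m)) (lprod w (s + m) n) _ qb Q).
  + by move=> phi; exact: blk_part.
  + by move=> z; exact: glue_blk.
  + move=> y' z hy' hz; split; first exact: glue_eq hy' hz.
      by rewrite -(lprod_causal s cw hz) /lprod (@prod_split _ s (s + m)).
    by rewrite (qbE _ _ hz).
  + have h : attain (blk s (s + m) y) (lprod w s (s + m)) qb
        (m%:R * e) (m%:R * r + ln N.+1%:R) S.
      by have := steered_block (s := s) (s' := s + m) y hw; rewrite addKn; apply; lia.
    (* The costs [ln N.+1] and [S] of a block are spread over its [m >= l] letters. *)
    apply: (attain_le _ _ _ h) => //.
    * rewrite mulrDr lerD2l mulrCA ler_peMr ?ln_ge0 ?ler1n//.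
      by rewrite ler_pdivlMr// mul1r ler_nat.
    * by rewrite mulrCA ler_peMr// ler_pdivlMr// mul1r ler_nat.
  + by move=> y' _; exact: hQ.
Qed.

End Tail.
End Cylinders.

(** * Renyi capacity and Renyi centers *)

Section Capacity.
Context {R : realType} {X Y : finType}.
Variables (W : X -> Y -> R) (a : R).
Hypothesis hW : is_channel W.
Hypothesis a01 : 0 < a < 1.
Hypothesis X0 : (0 < #|X|)%N.
Implicit Types p : {ffun X -> R}.

Definition tsum (p : X -> R) y := \sum_x p x * W x y `^ a.
(** The argument of the logarithm in the Renyi information. For [a < 1] the prefactor [a / (a - 1)]
    is negative, so capacity amounts to minimizing [tpow]. *)
Definition tpow (p : X -> R) := \sum_y tsum p y `^ a^-1.

Let a0 : 0 < a. Proof. by have /andP[] := a01. Qed.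
Let a1 : a < 1. Proof. by have /andP[] := a01. Qed.
Let r1 : 1 < a^-1. Proof. by rewrite invf_gt1. Qed.

Lemma channel_ge0 x y : 0 <= W x y. Proof. by have [] := hW x. Qed.

Lemma channel_le1 x y : W x y <= 1.
Proof.
have [h <-] := hW x; rewrite (bigD1 y)//= lerDl; exact: sumr_ge0.
Qed.

Lemma channel_out : (0 < #|Y|)%N.
Proof.
have /card_gt0P[x _] := X0; rewrite lt0n; apply/eqP => Y0.
have [_ h] := hW x; have := oner_neq0 R; rewrite -h big_pred0 ?eqxx// => y.
by move: (card0_eq Y0 y); rewrite inE.
Qed.

Lemma renyi_infoE p : renyi_info a p W = a / (a - 1) * ln (tpow p).
Proof. by rewrite /renyi_info ifN ?lt_eqF. Qed.

Lemma tsum_ge0 (p : X -> R) y : (forall x, 0 <= p x) -> 0 <= tsum p y.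
Proof. by move=> p0; apply: sumr_ge0 => x _; rewrite mulr_ge0 ?powR_ge0. Qed.

Lemma tsum_ge1 (p : X -> R) : (forall x, 0 <= p x) -> \sum_x p x = 1 -> 1 <= \sum_y tsum p y.
Proof.
move=> p0 p1; rewrite exchange_big/= -[X in X <= _]p1; apply: ler_sum => x _.
have [_ h] := hW x; rewrite -mulr_sumr -[leLHS]mulr1 ler_wpM2l// -h.
apply: ler_sum => y _; have := channel_ge0 x y; rewrite le_eqVlt => /predU1P[<-|w0].
  exact: powR_ge0.
by rewrite ger1_powR ?w0 ?channel_le1 ?ltW.
Qed.

(** Jensen's inequality through tangents at the constant [1 / #|Y|]; the linear terms sum to a
    nonnegative number by [tsum_ge1]. *)
Lemma tpow_ge (p : X -> R) : (forall x, 0 <= p x) -> \sum_x p x = 1 ->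
  #|Y|%:R `^ (1 - a^-1) <= tpow p.
Proof.
move=> p0 p1; set N : R := #|Y|%:R.
have N0 : 0 < N by rewrite ltr0n channel_out.
have u0 : 0 <= N^-1 by rewrite invr_ge0 ltW.
apply: (@le_trans _ _ (\sum_y (N^-1 `^ a^-1 + a^-1 * (N^-1 `^ (a^-1 - 1) * (tsum p y - N^-1))))).
  rewrite big_split/= sumr_const -!mulr_sumr sumrB sumr_const -mulr_natl -/N -mulr_natl -/N.
  rewrite mulfV ?lt0r_neq0//.
  have -> : N * N^-1 `^ a^-1 = N `^ (1 - a^-1).
    rewrite -[X in X * _](@powRr1 R) ?ltW// -(powR_inv1 (ltW N0)) -powRrM mulN1r.
    by rewrite -powRD// lt0r_neq0 ?implybT.
  rewrite lerDl !mulr_ge0 ?powR_ge0 ?invr_ge0 ?(ltW a0)//.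
  by rewrite subr_ge0 tsum_ge1.
by apply: ler_sum => y _; apply: powR_tangent => //; exact: tsum_ge0.
Qed.

Lemma tpow_gt0 (p : X -> R) : (forall x, 0 <= p x) -> \sum_x p x = 1 -> 0 < tpow p.
Proof.
by move=> p0 p1; apply: lt_le_trans (tpow_ge p0 p1); rewrite powR_gt0// ltr0n channel_out.
Qed.

Lemma renyi_info_le p : distributions p -> renyi_info a p W <= ln #|Y|%:R.
Proof.
move=> [p0 p1]; rewrite renyi_infoE.
have N0 : (0 : R) < #|Y|%:R by rewrite ltr0n channel_out.
have F0 := tpow_gt0 p0 p1.
have h : (1 - a^-1) * ln #|Y|%:R <= ln (tpow p).
  by rewrite -ln_powR ler_ln ?posrE ?powR_gt0//; exact: tpow_ge.
have ca : a / (a - 1) < 0 by rewrite pmulr_rlt0// invr_lt0 subr_lt0 a1.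
apply: le_trans (_ : a / (a - 1) * ((1 - a^-1) * ln #|Y|%:R) <= _).
  by rewrite ler_nM2l.
rewrite mulrA (_ : a / (a - 1) * (1 - a^-1) = 1) ?mul1r//.
have h0 := a0; have h1 := a1; field; lra.
Qed.

(** Ensures that the [sup] in [renyi_cap] is a true supremum and not a default value. *)
Lemma renyi_ubound : has_ubound [set renyi_info a p W | p in @distributions R X].
Proof. by exists (ln #|Y|%:R) => _ [p hp <-]; exact: renyi_info_le. Qed.

Lemma distributions_nonempty : @distributions R X !=set0.
Proof.
have /card_gt0P[x0 _] := X0; exists [ffun x => (x == x0)%:R]; split.
  by move=> x; rewrite ffunE ler0n.
rewrite (bigD1 x0)//= ffunE eqxx big1 ?addr0// => x /negbTE h.
by rewrite ffunE h.
Qed.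

Lemma renyi_info_le_cap p : distributions p -> renyi_info a p W <= renyi_cap a W.
Proof. by move=> hp; apply: ub_le_sup renyi_ubound _ _; exists p. Qed.

Lemma renyi_cap_le : renyi_cap a W <= ln #|Y|%:R.
Proof.
apply: ge_sup; last by move=> _ [p hp <-]; exact: renyi_info_le.
by have [p hp] := distributions_nonempty; exists (renyi_info a p W), p.
Qed.

End Capacity.

(** * Minimizers of continuous functions on the simplex *)

Section Center.
Context {R : realType}.

(** The absolute value extends the power continuously to the whole line, so that [tpow] becomes
    continuous on all vectors. *)
Lemma continuous_norm_powR (e : R) : 0 < e -> continuous (fun u : R => `|u| `^ e).
Proof.
move=> e0 x; have [->|x0] := eqVneq x 0.
  apply/cvgrPdist_lt => d d0; rewrite normr0 powR0 ?lt0r_neq0//.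
  near=> u; rewrite sub0r normrN ger0_norm ?powR_ge0//.
  have -> : d = (d `^ e^-1) `^ e.
    by rewrite -powRrM mulVf ?lt0r_neq0// powRr1 ?ltW.
  rewrite gt0_ltr_powR ?nnegrE ?powR_ge0//.
  near: u; exists (d `^ e^-1) => /=; first exact: powR_gt0.
  by move=> u; rewrite /ball_/= sub0r normrN.
have nx : 0 < `|x| by rewrite normr_gt0.
have near_eq : {near nbhs x, (fun u => expR (e * ln `|u|)) =1 (fun u : R => `|u| `^ e)}.
  near=> u; rewrite /powR normr_eq0 ifF//; apply/negbTE.
  by near: u; exact: open_neq.
have e1 : `|x| `^ e = expR (e * ln `|x|) by rewrite /powR normr_eq0 (negbTE x0).
rewrite /continuous_at/= e1.
apply: cvg_trans (near_eq_cvg near_eq) _.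
apply: continuous_cvg; first exact: continuous_expR.
apply: cvgMl_tmp; apply: (@cvg_comp _ _ _ (fun u : R => `|u|) (@ln R) _ (nbhs `|x|)).
  exact: norm_continuous.
exact: continuous_ln.
Unshelve. all: by end_near.
Qed.

(** The simplex is a closed part of a compact cube of row vectors, to which distributions are
    transported by enumerating [X]. *)
Lemma min_on_simplex (X : finType) (f : 'rV[R]_#|X| -> R) :
  (0 < #|X|)%N -> continuous f ->
  exists2 p : {ffun X -> R}, distributions p &
  forall p' : {ffun X -> R}, distributions p' ->
    f (\row_i p (enum_val i)) <= f (\row_i p' (enum_val i)).
Proof.
move=> X0 cf.
pose A : set 'rV[R]_#|X| := [set v | forall i, `[0, 1]%classic (v ord0 i)] `&`
  [set v | \sum_i v ord0 i = 1].
have sumE (F : 'I_#|X| -> R) : \sum_i F i = \sum_x F (enum_rank x).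
  by rewrite (reindex (@enum_rank X))//; exact/onW_bij/enum_rank_bij.
have hA (p : {ffun X -> R}) : distributions p -> A (\row_i p (enum_val i)).
  move=> [p0 p1]; split => /=.
    move=> i; rewrite mxE in_itv/= p0/= -p1 (bigD1 (enum_val i))//= lerDl.
    exact: sumr_ge0.
  by rewrite sumE -[RHS]p1; apply: eq_bigr => x _; rewrite mxE enum_rankK.
have cs : continuous (fun v : 'rV[R]_#|X| => \sum_i v ord0 i).
  apply: continuous_big; first exact: add_continuous.
  by move=> i _; exact: coord_continuous.
have cA : compact A.
  have c1 : compact [set v : 'rV[R]_#|X| | forall i, `[0, 1]%classic (v ord0 i)].
    apply: (@rV_compact R #|X| (fun=> `[0, 1]%classic)) => i.
    exact: segment_compact.
  have c2 : closed ((fun v : 'rV[R]_#|X| => \sum_i v ord0 i) @^-1` [set x | x = 1]).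
    by apply: closed_comp; [move=> v _; exact: cs|exact: closed_eq].
  exact: compact_closedI c1 c2.
have [||c cA' hc] := @EVT_min_rV R #|X| f A _ cA _.
- by have [p /hA hp] := @distributions_nonempty R X X0; exists (\row_i p (enum_val i)).
- exact: continuous_subspaceT.
move: cA'; rewrite inE => -[/= c0 c1].
exists [ffun x => c ord0 (enum_rank x)].
  split=> [x|]; first by rewrite ffunE; have := c0 (enum_rank x); rewrite in_itv/= => /andP[].
  by under eq_bigr do rewrite ffunE; rewrite -sumE.
move=> p' hp'; have -> : \row_i [ffun x => c ord0 (enum_rank x)] (enum_val i) = c.
  by apply/rowP => i; rewrite mxE ffunE enum_valK.
by apply: hc; rewrite inE; exact: hA.
Qed.

End Center.

(** * Optimality conditions and the Renyi center *)

Section Kuhn_Tucker.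
Context {R : realType} {X Y : finType}.
Variables (W : X -> Y -> R) (a : R).
Hypothesis hW : is_channel W.
Hypothesis a01 : 0 < a < 1.
Hypothesis X0 : (0 < #|X|)%N.

Lemma tpow_min : exists2 p : {ffun X -> R}, distributions p &
  forall p' : {ffun X -> R}, distributions p' -> tpow W a p <= tpow W a p'.
Proof.
have [a0 a1] := andP a01.
pose f (v : 'rV[R]_#|X|) :=
  \sum_y `|\sum_x v ord0 (enum_rank x) * W x y `^ a| `^ a^-1.
have cf : continuous f.
  apply: continuous_big; first exact: add_continuous.
  move=> y _ v.
  apply: (@cvg_comp _ _ _ (fun v : 'rV[R]_#|X| => \sum_x v ord0 (enum_rank x) * W x y `^ a)
    (fun u : R => `|u| `^ a^-1) _ (nbhs (\sum_x v ord0 (enum_rank x) * W x y `^ a))).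
    move: v; apply: continuous_big; first exact: add_continuous.
    move=> x _ v; apply: (@continuousM _ _ (fun v : 'rV[R]_#|X| => v ord0 (enum_rank x)) (fun=> W x y `^ a)).
      exact: coord_continuous.
    exact: cst_continuous.
  by apply: continuous_norm_powR; rewrite invr_gt0.
have fE (p : {ffun X -> R}) : distributions p -> f (\row_i p (enum_val i)) = tpow W a p.
  move=> [p0 _]; apply: eq_bigr => y _; congr (_ `^ _).
  rewrite (eq_bigr (fun x => p x * W x y `^ a)) => [|x _]; last by rewrite mxE enum_rankK.
  by rewrite ger0_norm// tsum_ge0.
have [p hp h] := min_on_simplex X0 cf; exists p => // p' hp'.
by rewrite -!fE//; exact: h.
Qed.

Lemma renyi_capE (p : {ffun X -> R}) : distributions p ->
  (forall p' : {ffun X -> R}, distributions p' -> tpow W a p <= tpow W a p') ->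
  renyi_cap a W = a / (a - 1) * ln (tpow W a p).
Proof.
move=> hp hmin; have [a0 a1] := andP a01; have [p0 p1] := hp.
rewrite -renyi_infoE//; apply/le_anti; rewrite (renyi_info_le_cap hW a01 X0 hp) andbT.
apply: ge_sup; first by exists (renyi_info a p W), p.
move=> _ [p' hp' <-]; have [p0' p1'] := hp'.
have ca : a / (a - 1) < 0 by rewrite pmulr_rlt0// invr_lt0 subr_lt0.
by rewrite !renyi_infoE// ler_nM2l// ler_ln ?posrE ?hmin// (tpow_gt0 hW).
Qed.

(** First-order optimality when the minimizer [p] moves towards the point mass at [x0]. *)
Lemma kuhn_tucker (p : {ffun X -> R}) x0 : distributions p ->
  (forall p' : {ffun X -> R}, distributions p' -> tpow W a p <= tpow W a p') ->
  tpow W a p <= \sum_y W x0 y `^ a * tsum W a p y `^ (a^-1 - 1).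
Proof.
move=> [p0 p1] hmin; have [a0 a1] := andP a01.
have r1 : 1 < a^-1 by rewrite invf_gt1.
have r0 : 0 < a^-1 by rewrite invr_gt0.
set A := tsum W a p; have A0 y : 0 <= A y by exact: tsum_ge0.
set B := fun y => W x0 y `^ a.
(* Up to the factor [a^-1], the derivative of [tpow] along the segment. The tangent at the moved
   point, compared with minimality at [s = 0], gives [G s >= 0]; then [s] tends to 0. *)
pose G (s : R) := \sum_y `|A y + s * (B y - A y)| `^ (a^-1 - 1) * (B y - A y).
have G0 s : 0 < s < 1 -> 0 <= G s.
  move=> /andP[s0 s1].
  pose ps := [ffun x => (1 - s) * p x + s * (x == x0)%:R].
  have hps : distributions ps.
    split=> [x|]; first by rewrite ffunE addr_ge0// mulr_ge0// ?subr_ge0 ?ler0n// ltW.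
    under eq_bigr do rewrite ffunE.
    rewrite big_split/= -!mulr_sumr p1 (bigD1 x0)//= eqxx big1 => [|x /negbTE->//].
    by rewrite addr0 mulr1n !mulr1 subrK.
  have psE y : tsum W a ps y = A y + s * (B y - A y).
    rewrite /tsum; under eq_bigr do rewrite ffunE mulrDl -!mulrA.
    rewrite big_split/= -!mulr_sumr -/(tsum W a p y) -/A.
    rewrite [X in _ + s * X = _](bigD1 x0)//= eqxx mulr1n mul1r big1 => [|x /negbTE->]; last by rewrite mul0r.
    by rewrite -/(B y); ring.
  have As0 y : 0 <= A y + s * (B y - A y) by rewrite -psE; apply: tsum_ge0; exact: hps.1.
  have h : tpow W a ps + a^-1 * \sum_y
      ((A y + s * (B y - A y)) `^ (a^-1 - 1) * (- (s * (B y - A y)))) <= tpow W a p.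
    rewrite mulr_sumr -big_split/=; apply: ler_sum => y _; rewrite psE.
    have := powR_tangent (As0 y) (A0 y) r1.
    by rewrite (_ : A y - _ = - (s * (B y - A y)))//; ring.
  have := le_trans h (hmin _ hps); rewrite gerDl pmulr_rle0//.
  rewrite (eq_bigr (fun y => (- s) * (`|A y + s * (B y - A y)| `^ (a^-1 - 1) * (B y - A y)))).
    by rewrite -mulr_sumr nmulr_rle0// oppr_lt0.
  by move=> y _; rewrite ger0_norm//; ring.
have cG : continuous G.
  apply: continuous_big; first exact: add_continuous.
  move=> y _ s; apply: (@continuousM _ _ (fun s : R => `|A y + s * (B y - A y)| `^ (a^-1 - 1))
    (fun=> B y - A y)); last exact: cst_continuous.
  apply: (@cvg_comp _ _ _ (fun s : R => A y + s * (B y - A y))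
    (fun u : R => `|u| `^ (a^-1 - 1)) _ (nbhs (A y + s * (B y - A y)))).
    by apply: cvgD; [exact: cvg_cst|apply: cvgMr_tmp; exact: cvg_id].
  by apply: continuous_norm_powR; rewrite subr_gt0.
have {}cG : G s @[s --> 0^'+] --> G 0 by apply: cvg_at_right_filter; exact: cG.
have : 0 <= G 0.
  apply: cvgr_to_ge cG _; near=> s; apply: G0; apply/andP; split; near: s.
    exact: nbhs_right_gt.
  exact: nbhs_right_lt.
rewrite /G (eq_bigr (fun y => W x0 y `^ a * A y `^ (a^-1 - 1) - A y `^ a^-1)).
  by rewrite sumrB subr_ge0.
move=> y _; rewrite mul0r addr0 ger0_norm// mulrBr [_ * B y]mulrC [_ * A y]mulrC.
by rewrite mulr_powRB1.
Unshelve. all: by end_near.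
Qed.

(** Normalize [tsum^(1/a)] at the optimal input. Then [kuhn_tucker] says that every row of [W] has
    Renyi divergence at most the capacity from it. *)
Lemma renyi_center : exists q : Y -> R, [/\ forall y, 0 <= q y, \sum_y q y = 1 &
  forall x, expR (- ((1 - a) * renyi_cap a W)) <= \sum_y W x y `^ a * q y `^ (1 - a)].
Proof.
have [a0 a1] := andP a01; have [p hp hmin] := tpow_min; have [p0 p1] := hp.
have F0 := tpow_gt0 hW a01 X0 p0 p1; set F := tpow W a p in F0.
have A0 y : 0 <= tsum W a p y by exact: tsum_ge0.
exists (fun y => tsum W a p y `^ a^-1 / F); split.
- by move=> y; rewrite mulr_ge0 ?powR_ge0// invr_ge0 ltW.
- by rewrite -mulr_suml divff// lt0r_neq0.
move=> x; rewrite (renyi_capE hp hmin) -/F.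
have -> : - ((1 - a) * (a / (a - 1) * ln F)) = a * ln F by field; lra.
have -> : expR (a * ln F) = F * (F^-1) `^ (1 - a).
  rewrite /powR gt_eqF ?invr_gt0// lnV ?posrE//.
  by rewrite -[X in _ = X * _](@lnK R F) ?posrE// -expRD; congr expR; ring.
rewrite (eq_bigr (fun y => W x y `^ a * tsum W a p y `^ (a^-1 - 1) * F^-1 `^ (1 - a))).
  by rewrite -mulr_suml ler_wpM2r ?powR_ge0//; exact: kuhn_tucker.
move=> y _; rewrite powRM ?powR_ge0 ?invr_ge0 ?(ltW F0)// -powRrM mulrA.
by congr (_ * _ `^ _ * _); field; lra.
Qed.

End Kuhn_Tucker.

(** * Product channels and feedback *)

Section ProductChannel.
Context {R : realType} {X Y : nat -> finType}.
Variable W : forall t, X t -> Y t -> R.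
Hypothesis hW : forall t, (0 < t)%N -> is_channel (@W t).
Hypothesis hX : forall t, (0 < t)%N -> (0 < #|X t|)%N.

Lemma prod_in_inhabited (Z : nat -> finType) t n :
  (forall s, (0 < s)%N -> (0 < #|Z s|)%N) -> (0 < t)%N -> prod_in Z t n.
Proof.
move=> hZ t0; apply: finfun => i.
have /card_gt0P/cid[z _] : (0 < #|Z (t + i)%N|)%N by apply: hZ; lia.
exact: z.
Qed.

Lemma Y_card_gt0 t : (0 < t)%N -> (0 < #|Y t|)%N.
Proof. by move=> t0; exact: channel_out (hW t0) (hX t0). Qed.

Lemma prod_chan_channel t n : (0 < t)%N -> is_channel (prod_chan (@W) t n).
Proof.
move=> t0 x; split=> [y|].
  by apply: prodr_ge0 => i _; apply: (channel_ge0 (hW _)); lia.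
rewrite (sum_prod_dffun (prod_in_inhabited n Y_card_gt0 t0) (fun i u => W (x i) u)).
by rewrite big1// => i _; have [|_ ->] := @hW (t + i)%N _ (x i); first lia.
Qed.

Lemma prod_in_card t n : (0 < t)%N -> (0 < #|prod_in X t n|)%N.
Proof. by move=> t0; apply/card_gt0P; exists (prod_in_inhabited n hX t0). Qed.

Lemma ln_prod (I : finType) (x : I -> R) : (forall i, 0 < x i) ->
  ln (\prod_i x i) = \sum_i ln (x i).
Proof.
move=> x0; have [] : 0 < \prod_i x i /\ ln (\prod_i x i) = \sum_i ln (x i); last by [].
apply: (big_ind2 (fun u v => 0 < u /\ ln u = v)) => [|u v u' v' [u0 <-] [u0' <-]|//].
  by rewrite ltr01 ln1.
by rewrite mulr_gt0// lnM ?posrE.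
Qed.

(** The product of the optimal letter inputs is an admissible input, and [tpow] factorizes on it. *)
Lemma renyi_cap_prod a t n : 0 < a < 1 -> (0 < t)%N ->
  \sum_(i < n) renyi_cap a (@W (t + i)%N) <= renyi_cap a (prod_chan (@W) t n).
Proof.
move=> a01 t0; have ti i : (0 < t + i)%N by lia.
have y0 := prod_in_inhabited n Y_card_gt0 t0.
have x0 := prod_in_inhabited n hX t0.
have mins (i : 'I_n) := cid2 (tpow_min (@W (t + i)%N) a01 (hX (ti i))).
pose p (i : 'I_n) := s2val (mins i).
have hp (i : 'I_n) : distributions (p i) := s2valP (mins i).
have hmin (i : 'I_n) : forall p' : {ffun X (t + i)%N -> R}, distributions p' ->
    tpow (@W (t + i)%N) a (p i) <= tpow (@W (t + i)%N) a p'
  := s2valP' (mins i).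
pose P : {ffun prod_in X t n -> R} := [ffun x : prod_in X t n => \prod_(i < n) p i (x i)].
have hP : distributions P.
  split=> [x|]; first by rewrite ffunE prodr_ge0// => i _; exact: (hp i).1.
  under eq_bigr do rewrite ffunE.
  rewrite (sum_prod_dffun x0 (fun i u => p i u)) big1// => i _; exact: (hp i).2.
have tE y : tsum (prod_chan (@W) t n) a P y = \prod_(i < n) tsum (@W (t + i)%N) a (p i) (y i).
  rewrite -(sum_prod_dffun x0 (fun i u => p i u * W u (y i) `^ a)).
  apply: eq_bigr => x _; rewrite ffunE powR_prod ?big_split// => i.
  exact: (channel_ge0 (hW (ti i))).
have tpE : tpow (prod_chan (@W) t n) a P = \prod_(i < n) tpow (@W (t + i)%N) a (p i).
  rewrite -(sum_prod_dffun y0 (fun i u => tsum (@W (t + i)%N) a (p i) u `^ a^-1)).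
  apply: eq_bigr => y _; rewrite tE powR_prod// => i.
  by apply: tsum_ge0; exact: (hp i).1.
apply: (le_trans _ (renyi_info_le_cap (prod_chan_channel t0) a01 (prod_in_card n t0) hP)).
rewrite renyi_infoE// tpE ln_prod => [|i]; last first.
  exact: (tpow_gt0 (hW (ti i)) a01 (hX (ti i)) (hp i).1 (hp i).2).
rewrite mulr_sumr; apply: ler_sum => i _.
by rewrite (renyi_capE (hW (ti i)) a01 (hX (ti i)) (hp i) (hmin i)).
Qed.

Lemma sum_window n s s' (F : nat -> R) : (s <= s' <= n)%N ->
  \sum_(i < n | (s <= i < s')%N) F i = \sum_(i < s' - s) F (s + i)%N.
Proof.
move=> /andP[ss' s'n]; rewrite -(big_mkord (fun i => (s <= i < s')%N) F).
under eq_bigl do rewrite andbC.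
rewrite -[LHS](@big_nat_widenl _ _ _ s 0 n (fun i => (i < s')%N)) //.
rewrite -(@big_nat_widen _ _ _ s s' n predT) //.
rewrite -{1}[s]add0n big_addn big_mkord.
by apply: eq_bigr => i _; rewrite addnC.
Qed.

End ProductChannel.

(** * Converse for list codes with feedback *)

Section Feedback.
Context {R : realType} {X Y : nat -> finType}.
Variable W : forall t, X t -> Y t -> R.
Hypothesis hW : forall t, (0 < t)%N -> is_channel (@W t).
Hypothesis hX : forall t, (0 < t)%N -> (0 < #|X t|)%N.

(** Once the past outputs are given, the strategy sends one definite letter, and the center bound
    holds for every letter. *)
Lemma steered_feedback n N (b : nat -> R) (q : nat -> forall i : 'I_n, Y (1 + i)%N -> R)
   (e : fb_in X Y n) :
  (forall (j : nat) (i : 'I_n) x, (j <= N)%N ->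
    expR (- ((1 - b j) * renyi_cap (b j) (@W (1 + i)%N))) <=
     \sum_y W x y `^ b j * q j i y `^ (1 - b j)) ->
  steered N b q (fun j i => renyi_cap (b j) (@W (1 + i)%N))
    (fun i (y : fb_out Y n) => W (e i (Defs.prefix y i)) (y i)).
Proof.
move=> hq; have pE (i : 'I_n) (y z : fb_out Y n) :
    (forall j : 'I_n, (j < i)%N -> y j = z j) -> Defs.prefix y i = Defs.prefix z i.
  by move=> h; apply/ffunP => j; rewrite !ffunE; exact: (h (widen_ord (ltnW (ltn_ord i)) j) (ltn_ord j)).
have bE (i : 'I_n) (y z : fb_out Y n) : blk i i.+1 y z -> Defs.prefix z i = Defs.prefix y i.
  by move=> /blkP h; apply: pE => j ji; apply: h; lia.
split.
- move=> i y z h; rewrite (pE i y z) => [|j ji]; last by apply: h; exact: ltnW.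
  by rewrite h.
- by move=> i z; apply: (channel_ge0 (hW _)).
- move=> i z.
  rewrite (eq_bigr (fun z' : fb_out Y n => W (e i (Defs.prefix z i)) (z' i))) => [|z' h];
    last by rewrite (bE i z).
  rewrite (sum_blk_letter (i := i) z (fun u => W (e i (Defs.prefix z i)) u)).
  by have [|_ ->] := @hW (1 + i)%N _ (e i (Defs.prefix z i)).
- move=> j i z jN; pose x := e i (Defs.prefix z i).
  rewrite (eq_bigr (fun z' : fb_out Y n => W x (z' i) `^ b j * q j i (z' i) `^ (1 - b j))) => [|z' h];
    last by rewrite (bE i z).
  by rewrite (sum_blk_letter (i := i) z (fun u => W x u `^ b j * q j i u `^ (1 - b j))); exact: hq.
Qed.

(** Average over messages: each output lies in exactly [L] decoding regions, so their [Q]-masses add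
    up to [L]. *)
Lemma avg_err_converse (In Out : finType) (V : In -> Out -> R) (M L : nat)
   (f : 'I_M -> In) (psi : Out -> {set 'I_M}) (Q : Out -> R) (A B : R) :
  (0 < M)%N -> (forall y, #|psi y| = L) -> \sum_y Q y = 1 ->
  (forall m, 3 / 4 <= A * \sum_(y | m \notin psi y) V (f m) y +
                      B * \sum_(y | m \in psi y) Q y) ->
  3 / 4 <= A * avg_err V f psi + B * (L%:R / M%:R).
Proof.
move=> M0 hpsi Q1 h; have M0' : (0 : R) < M%:R by rewrite ltr0n.
have : \sum_(m < M) (3 / 4) <= \sum_(m < M) (A * \sum_(y | m \notin psi y) V (f m) y +
    B * \sum_(y | m \in psi y) Q y) by apply: ler_sum => m _.
rewrite sumr_const card_ord big_split/= -!mulr_sumr.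
have -> : \sum_(m < M) \sum_(y | m \in psi y) Q y = L%:R.
  under eq_bigr do rewrite big_mkcond/=.
  rewrite exchange_big/= -[RHS]mulr1 -[X in _ = _ * X]Q1 mulr_sumr; apply: eq_bigr => y _.
  by rewrite -big_mkcond/= sumr_const hpsi -[LHS]mulr_natl.

rewrite -[_ *+ M]mulr_natr -ler_pdivlMr// => /le_trans; apply.
by rewrite /avg_err le_eqVlt; apply/orP; left; apply/eqP; field; lra.
Qed.

Lemma feedback_converse n N (b : nat -> R) (c : nat -> nat -> R) (l : nat)
   (D th H e r S tau : R) (t := fun j => (1 - b j) / b j)
   (M L : nat) (f : 'I_M -> fb_in X Y n) (psi : fb_out Y n -> {set 'I_M}) :
  (forall j, 0 < b j < 1) ->
  (forall j m s, (j <= N)%N -> (l <= m)%N -> (m < 2 * l)%N -> (0 < s)%N ->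
     renyi_cap (b j) (prod_chan (@W) s m) <= c j m) ->
  (forall j, (j < N)%N -> t j.+1 <= t j) -> (0 < l <= n)%N -> 0 <= S ->
  (forall m, (l <= m)%N -> (m < 2 * l)%N ->
  [/\ c 0%N m <= m%:R * r,
  (forall j, (j < N)%N -> t j * (c j m - m%:R * r) <= m%:R * e /\
       t j * (c j.+1 m - m%:R * r) <= m%:R * e),
  t N * c N m <= m%:R * e,
  (forall j, (j <= N)%N -> [/\ c j m <= D, t j <= th & (t j)^-1 <= H]) &
  2 * (2 * th ^+ 2 * (D ^+ 2 + 1) + 1) + 2 * (m%:R * e) ^+ 2 <= S /\
  2 * (2 * (2 * (D ^+ 2 + H ^+ 2) + ln N.+1%:R ^+ 2) + 1)
     + 2 * (m%:R * r + ln N.+1%:R) ^+ 2 <= S]) ->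
  0 < tau -> 8 * (n%:R * (S / l%:R)) <= tau ^+ 2 ->
  (0 < M)%N -> (forall y, #|psi y| = L) ->
  3 / 4 <= expR (n%:R * e + tau) * avg_err (fb_chan (@W) n) f psi +
    expR (n%:R * (r + ln N.+1%:R / l%:R) + tau) * (L%:R / M%:R).
Proof.
move=> b01 hc tmono /andP[l0 ln'] S0 hblock tau0 htau M0 hpsi.
have /choice[q hq] : forall j, exists q : forall i : 'I_n, Y (1 + i)%N -> R, forall i,
   [/\ forall y, 0 <= q i y, \sum_y q i y = 1 &
   forall x, expR (- ((1 - b j) * renyi_cap (b j) (@W (1 + i)%N))) <=
     \sum_y W x y `^ b j * q i y `^ (1 - b j)].
  move=> j; have h (i : 'I_n) :=
    cid (renyi_center (hW (t := (1 + i)%N) isT) (b01 j) (hX (t := (1 + i)%N) isT)).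
  by exists (fun i => sval (h i)) => i; exact: svalP (h i).
have [||Q [Q0 Q1 hQ]] := @steered_tail R n (fun i => Y (1 + i)%N) N b q
   (fun j i => renyi_cap (b j) (@W (1 + i)%N)) c l D th H e r S b01
   (fun j i => let: And3 h _ _ := hq j i in h) (fun j i => let: And3 _ h _ := hq j i in h)
   _ tmono l0 S0 hblock 0%N (leq0n n).
- move=> j s s' jN h1 h2 h3.
  rewrite (sum_window (fun i => renyi_cap (b j) (@W (1 + i)%N))); last by lia.
  (* Coordinates count from 0 and channels from 1, so the window at [s] begins with channel
     [s.+1]. *)
  apply: le_trans (hc j (s' - s)%N s.+1 jN _ _ isT); [|lia|lia].
  exact: (renyi_cap_prod hW hX (s' - s)%N (b01 j) (ltn0Sn s)).
- by right; lia.
rewrite subn0 in hQ.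
have y0 : fb_out Y n := prod_in_inhabited n (Y_card_gt0 hW hX) (ltn0Sn 0).
have full : blk 0 n y0 = predT by apply: funext => z; rewrite blk_full.
apply: (avg_err_converse M0 hpsi (Q := Q)).
  by rewrite -(Q1 y0); apply: eq_bigl => z; rewrite blk_full.
move=> m.
have hs := steered_feedback (f m) (fun j i x (jN : (j <= N)%N) => let: And3 _ _ h := hq j i in h x).
have wE : lprod (fun i (y : fb_out Y n) => W (f m i (Defs.prefix y i)) (y i)) 0 n =
    fb_chan (@W) n (f m) by apply: funext => z; rewrite lprod_full.
have := hQ _ y0 hs; rewrite full wE => ha.
have := attain_converse (fun y => m \in psi y) ha _ Q0 tau0 htau.
apply=> z; rewrite prodr_ge0// => i _; exact: (channel_ge0 (hW (t := (1 + i)%N) isT)).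
Qed.

End Feedback.

(** * Choice of the parameters *)

Section Numerics.
Context {R : realType}.
Implicit Types (x y nu a : R).

(** Equally spaced orders, constant after index [n] so that the range bound holds for every
    index. *)
Lemma order_grid a nu n : (0 < n)%N -> 0 < a -> 0 < nu -> 1 < nu * (1 - a) ->
  exists b : nat -> R, [/\ b 0%N = a, b n = 1 - nu^-1,
    forall j, a <= b j <= 1 - nu^-1 &
    forall j, (j < n)%N -> b j <= b j.+1 <= b j + n%:R^-1].
Proof.
move=> n0 a0 nu0 h; have n0' : (0 : R) < n%:R by rewrite ltr0n.
have nV : 0 < nu^-1 by rewrite invr_gt0.
have d0 : nu^-1 < 1 - a by rewrite -(ltr_pM2l nu0) mulfV ?lt0r_neq0.
have V0 : 0 < n%:R^-1 :> R by rewrite invr_gt0.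
set d := 1 - nu^-1 - a; have d0' : 0 <= d by rewrite /d; lra.
have d1 : d <= 1 by rewrite /d; lra.
exists (fun j => a + d * ((minn j n)%:R / n%:R)); split.
- by rewrite min0n mul0r mulr0 addr0.
- by rewrite minnn divff ?lt0r_neq0// mulr1 /d; ring.
- move=> j; apply/andP; split; first by rewrite lerDl mulr_ge0// divr_ge0.
  rewrite -lerBrDl -/d ler_piMr// ler_pdivrMr// mul1r ler_nat; exact: geq_minr.
- move=> j jn; have -> : minn j n = j by lia.
  have -> : minn j.+1 n = j.+1 by lia.
  have e : j.+1%:R / n%:R = j%:R / n%:R + n%:R^-1 :> R by rewrite -natr1 mulrDl mul1r.
  rewrite e mulrDr addrA lerDl mulr_ge0 ?(ltW V0)//=.
  by rewrite lerD2l ler_piMl// ltW.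
Qed.

Lemma theta_bounds a nu x y (th := fun x : R => (1 - x) / x) :
  0 < a -> 0 < nu -> a <= x -> x <= y -> y <= 1 - nu^-1 ->
  [/\ 0 < th x, th x <= a^-1, (th x)^-1 <= nu, th y <= th x &
   th x - th y <= (y - x) * a^-1 ^+ 2].
Proof.
move=> a0 nu0 ax xy y1; have nV : 0 < nu^-1 by rewrite invr_gt0.
have x0 : 0 < x by lra.
have y0 : 0 < y by lra.
have xV : x^-1 <= a^-1 by rewrite lef_pV2 ?posrE.
have yV : y^-1 <= a^-1 by rewrite lef_pV2 ?posrE//; lra.
have xV0 : 0 < x^-1 by rewrite invr_gt0.
have yV0 : 0 < y^-1 by rewrite invr_gt0.
have e : th x - th y = (y - x) * (x^-1 * y^-1) by rewrite /th; field; lra.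
split.
- by rewrite /th divr_gt0//; lra.
- apply: le_trans xV; rewrite /th ler_piMl//; lra.
- have h : nu^-1 <= 1 - x by lra.
  rewrite /th invf_div ler_pdivrMr; last by lra.
  have := ler_wpM2l (ltW nu0) h; rewrite mulfV ?lt0r_neq0//; lra.
- by rewrite -subr_ge0 e !mulr_ge0 ?subr_ge0// ltW.
- by rewrite e ler_wpM2l ?subr_ge0// expr2 ler_pM// ltW.
Qed.

(** The two variance conditions of [attain_block] with [th = A], [D = 2 nu^2 B] and [H = nu]: every
    term is of order [nu^4 = n]. *)
Lemma variance_bound A B nu m e r lnn (V := nu ^+ 4) :
  1 <= nu -> 0 <= A -> 0 <= B ->
  0 <= m * e <= 2 * nu ^+ 2 * (A * B + 1) -> 0 <= m * r <= 2 * nu ^+ 2 * B ->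
  0 <= lnn <= 5 * nu ->
  2 * (2 * A ^+ 2 * ((2 * nu ^+ 2 * B) ^+ 2 + 1) + 1) + 2 * (m * e) ^+ 2 <=
    (4 * A ^+ 2 * (4 * B ^+ 2 + 1) + 2 + 8 * (A * B + 1) ^+ 2) * V /\
  2 * (2 * (2 * ((2 * nu ^+ 2 * B) ^+ 2 + nu ^+ 2) + lnn ^+ 2) + 1) + 2 * (m * r + lnn) ^+ 2 <=
    (8 * (4 * B ^+ 2 + 1) + 102 + 2 * (2 * B + 5) ^+ 2) * V.
Proof.
move=> nu1 A0 B0 /andP[me0 me1] /andP[mr0 mr1] /andP[l0 l1].
have sq x y : 0 <= x -> x <= y -> x ^+ 2 <= y ^+ 2.
  by move=> x0 xy; rewrite lerXn2r ?nnegrE//; lra.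
have n2 : 1 <= nu ^+ 2 by rewrite exprn_ege1.
have n12 : nu <= nu ^+ 2 by rewrite expr2 ler_peMr//; lra.
have VE : V = (nu ^+ 2) ^+ 2 by rewrite -exprM.
have n24 : nu ^+ 2 <= V by rewrite VE [leRHS]expr2 ler_peMr//; lra.
clearbody V.
split.
  have h1 := sq _ _ me0 me1.
  have h2 : 0 <= A ^+ 2 by exact: sqr_ge0.
  have h3 : 0 <= A ^+ 2 * (V - 1) by rewrite mulr_ge0//; lra.
  have -> : (2 * nu ^+ 2 * B) ^+ 2 = 4 * B ^+ 2 * V by rewrite VE; ring.
  have e1 : (2 * nu ^+ 2 * (A * B + 1)) ^+ 2 = 4 * (A * B + 1) ^+ 2 * V by rewrite VE; ring.
  rewrite e1 in h1; lra.
have h1 := sq _ _ l0 l1.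
have h2 : (m * r + lnn) ^+ 2 <= (nu ^+ 2 * (2 * B + 5)) ^+ 2.
  by apply: sq; lra.
have -> : (2 * nu ^+ 2 * B) ^+ 2 = 4 * B ^+ 2 * V by rewrite VE; ring.
have e1 : (nu ^+ 2 * (2 * B + 5)) ^+ 2 = (2 * B + 5) ^+ 2 * V by rewrite VE; ring.
have e2 : (5 * nu) ^+ 2 = 25 * nu ^+ 2 by ring.
rewrite e1 in h2; rewrite e2 in h1; lra.
Qed.

(** The sphere packing exponent may be infinite; [z] is a finite substitute that still dominates its
    terms up to the level [y]. *)
Lemma ereal_truncate (x : \bar R) (y : R) : (0 <= x)%E -> 0 <= y ->
  exists z : R, [/\ 0 <= z <= y, (z%:E <= x)%E &
   forall u : R, (u%:E <= x)%E -> u <= y -> u <= z].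
Proof.
case: x => [x||]; rewrite ?lee_fin => x0 y0.
- exists (Num.min x y); split=> [||u]; rewrite ?lee_fin ?le_min ?x0 ?y0 ?ge_min ?lexx ?orbT//.
  by move=> -> ->.
- by exists y; rewrite y0 lexx leey; split.
- by [].
Qed.

Lemma ln_le_root (n : nat) nu : (0 < n)%N -> 0 < nu -> n%:R = nu ^+ 4 -> ln n%:R <= 4 * nu.
Proof.
move=> n0 nu0 ->; rewrite lnXn// -mulr_natl.
by have := ln_sublinear nu0; lra.
Qed.

End Numerics.

Section BoundedCapacity.
Context {R : realType} {X Y : nat -> finType}.
Variable W : forall t, X t -> Y t -> R.
Hypothesis hW : forall t, (0 < t)%N -> is_channel (@W t).
Hypothesis hX : forall t, (0 < t)%N -> (0 < #|X t|)%N.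
Variables (g : R -> R) (K : R) (n0 : nat).
Hypothesis g0 : forall a, 0 < a < 1 -> 0 <= g a.
Hypothesis K0 : 0 <= K.
Hypothesis n00 : (0 < n0)%N.
Hypothesis hcap : forall n, (n0 <= n)%N -> forall a, 0 < a < 1 -> forall t, (0 < t)%N ->
  `|renyi_cap a (prod_chan (@W) t n) - n%:R * g a| <= K * ln n%:R.

(** One window of length [n0] suffices: its capacity is at most the logarithm of its output alphabet
    size, for every order. *)
Lemma g_bounded : exists2 G, 0 <= G & forall a, 0 < a < 1 -> g a <= G.
Proof.
have N0 : (0 : R) < n0%:R by rewrite ltr0n.
set G := (ln #|prod_in Y 1 n0|%:R + K * ln n0%:R) / n0%:R.
have hG a : 0 < a < 1 -> g a <= G.
  move=> a01; rewrite ler_pdivlMr//.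
  have := hcap (leqnn n0) a01 (ltn0Sn 0); rewrite ler_norml => /andP[h _].
  have := renyi_cap_le (prod_chan_channel hW hX (n := n0) (ltn0Sn 0)) a01
    (prod_in_card hX n0 (ltn0Sn 0)); lra.
have h2 : 0 < (1 / 2 : R) < 1 by lra.
by exists G => //; apply: le_trans (hG _ h2); exact: g0.
Qed.

End BoundedCapacity.

(** * The bound at a fixed blocklength *)

(** Here [nu] is the fourth root of [n]. The loss is a constant times [nu^3] without logarithm,
    which lets the factor [ln n] of the final statement absorb the constant. *)
Lemma blocklength_bound {R : realType} {X Y : nat -> finType}
   (W : forall t, X t -> Y t -> R) (g : R -> R) (K : R) (n0 : nat)
   (a0 a1 G A B Cv T C1 C2 : R) (n : nat) (nu : R) (M L : nat)
   (f : 'I_M -> fb_in X Y n) (psi : fb_out Y n -> {set 'I_M})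
   (r0 := ln (M%:R / L%:R)) :
  (forall t, (0 < t)%N -> is_channel (@W t)) ->
  (forall t, (0 < t)%N -> (0 < #|X t|)%N) ->
  (forall a, 0 < a < 1 -> 0 <= g a) -> 0 <= K -> (0 < n0)%N ->
  (forall n, (n0 <= n)%N -> forall a, 0 < a < 1 -> forall t, (0 < t)%N ->
    `|renyi_cap a (prod_chan (@W) t n) - n%:R * g a| <= K * ln n%:R) ->
  0 < a0 < 1 -> 0 < a1 < 1 -> 0 <= G -> (forall a, 0 < a < 1 -> g a <= G) ->
  A = a0^-1 -> B = G + K ->
  Cv = (4 * A ^+ 2 * (4 * B ^+ 2 + 1) + 2 + 8 * (A * B + 1) ^+ 2) +
    (8 * (4 * B ^+ 2 + 1) + 102 + 2 * (2 * B + 5) ^+ 2) ->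
  T = 4 * Cv -> C1 = 12 + T -> C2 = A * (12 * K + C1) + A ^+ 2 * B + A * B ->
  (n0 <= n)%N -> n%:R = nu ^+ 4 -> 3 <= nu -> n0%:R + 1 <= nu ->
  1 < nu * (1 - a0) -> C2 <= nu -> C1 <= ln n%:R ->
  (0 < L)%N -> (forall y, #|psi y| = L) ->
  r0 <= renyi_cap a1 (prod_chan (@W) 1 n) ->
  renyi_cap a0 (prod_chan (@W) 1 n) + (K + 1) * nu ^+ 3 * ln n%:R <= r0 ->
  exists2 E0 : R, (E0%:E <= Esp r0 (prod_chan (@W) 1 n))%E &
    expR (- (E0 + (C2 + T + 1) * nu ^+ 3)) <= avg_err (fb_chan (@W) n) f psi.
Proof.
move=> hW hX g0 K0 n00 hcap a01 a11 G0 gG AE BE CvE TE C1E C2E.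
move=> n0n nE nu3 nun0 nua hC2 + L0 hpsi.
have [cap capE] : exists cap : R -> R, forall a, renyi_cap a (prod_chan (@W) 1 n) = cap a.
  by exists (fun a => renyi_cap a (prod_chan (@W) 1 n)).
have [lnn lnnE] : exists x : R, ln n%:R = x by eexists.
have capn a : 0 < a < 1 -> `|cap a - n%:R * g a| <= K * lnn.
  by move=> a_in; rewrite -capE -lnnE; exact: hcap.
rewrite !capE lnnE => hC1 hr1 hr0.
(* For [M = 0] the convention [ln 0 = 0] would give [r0 = 0]. *)
have hML : 0 < r0 -> (0 < M)%N /\ L%:R / M%:R = expR (- r0) :> R.
  have [M_eq|M0 _] := posnP M; first by rewrite /r0 M_eq mulr0n mul0r ln0// ltxx.
  by split=> //; rewrite expRN /r0 lnK ?invf_div// posrE divr_gt0 ?ltr0n.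
have Esp_ge a : 0 < a -> (((1 - a) / a * (cap a - r0))%:E <=
    Esp r0 (prod_chan (@W) 1 n))%E.
  move=> a_gt0; rewrite -capE; apply: ereal_sup_ubound; exists a => //=.
  by rewrite in_itv/= a_gt0.
clearbody r0.
have n_gt0 : (0 < n)%N := leq_trans n00 n0n.
have N0 : (0 : R) < n%:R by rewrite ltr0n.
have nu0 : 0 < nu := lt_le_trans (ltr0Sn _ 2) nu3.
have [a0_gt0 a0_lt1] := andP a01.
have A1 : 1 <= A by rewrite AE invf_ge1// ltW.
have A_ge0 : 0 <= A := le_trans ler01 A1.
have B0 : 0 <= B by rewrite BE addr_ge0.
have AB : 0 <= A * B by rewrite mulr_ge0.
have CvA : 0 <= 4 * A ^+ 2 * (4 * B ^+ 2 + 1) + 2 + 8 * (A * B + 1) ^+ 2.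
  by rewrite !(addr_ge0, mulr_ge0)// ?sqr_ge0.
have CvB : 102 <= 8 * (4 * B ^+ 2 + 1) + 102 + 2 * (2 * B + 5) ^+ 2.
  by have := sqr_ge0 (2 * B + 5); have := sqr_ge0 B; clear; lra.
have Cv1 : 102 <= Cv by rewrite CvE -[leLHS]add0r lerD.
have Cv0 : 0 <= Cv by move: Cv1; clear; lra.
have T0 : 408 <= T by move: TE Cv1; clear; lra.
have C10 : 408 <= C1 by move: C1E T0; clear; lra.
have KC0 : 0 <= 12 * K + C1 by move: K0 C10; clear; lra.
have AC : 0 <= A * (12 * K + C1) by rewrite mulr_ge0.
have A2B : 0 <= A ^+ 2 * B by rewrite mulr_ge0 ?sqr_ge0.
have C20 : 0 <= C2 by rewrite C2E !addr_ge0.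
have lnn0 : 0 <= lnn by move: C10 hC1; clear; lra.
have lnn4 : lnn <= 4 * nu by rewrite -lnnE; exact: ln_le_root.
have nu2 : 9 <= nu ^+ 2 by move: nu3; clear; rewrite expr2; nra.
have nu21 : 1 <= nu ^+ 2 by move: nu2; clear; lra.
have nu2_ge0 : 0 <= nu ^+ 2 := sqr_ge0 nu.
have nu23 : 3 * nu ^+ 2 <= nu ^+ 3 by rewrite exprS ler_wpM2r.
have nu33 : 27 <= nu ^+ 3 by move: nu23 nu2; clear; lra.
have nu3_ge0 : 0 <= nu ^+ 3 by rewrite exprn_ge0// ltW.
have nu34 : nu ^+ 4 = nu ^+ 3 * nu by rewrite exprSr.
have nu22 : nu ^+ 4 = nu ^+ 2 * nu ^+ 2 by rewrite -exprD.
(* Blocks have lengths in [l, 2l), with [l] close to [sqrt n]. *)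
pose l := Num.truncn (nu ^+ 2).
have /andP[l1 l2] : l%:R <= nu ^+ 2 < l.+1%:R by apply: truncn_itv.
clearbody l.
(* Blocks longer than [n0] are within reach of the uniform capacity estimate. *)
have l_n0 : (n0 < l)%N.
  have h : n0%:R + 1 < l.+1%:R :> R.
    apply: le_lt_trans l2; apply: (le_trans nun0); rewrite expr2 ler_peMr ?(ltW nu0)//.
    by move: nu3; clear; lra.
  by move: h; rewrite natr1 ltr_nat ltnS.
have l_gt0 : (0 < l)%N := leq_ltn_trans (leq0n _) l_n0.
have l0 : (0 : R) < l%:R by rewrite ltr0n.
have l2n : (2 * l <= n)%N.
  rewrite -(ler_nat R) natrM nE nu22.
  by have h := ler_wpM2l nu2_ge0 nu2; move: h l1 nu2; clear; lra.
have nl : n%:R / l%:R <= 2 * nu ^+ 2.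
  have l1' : (1 : R) <= l%:R by rewrite ler1n.
  rewrite ler_pdivrMr// nE nu22 (_ : 2 * nu ^+ 2 * l%:R = nu ^+ 2 * (2 * l%:R)); last by ring.
  rewrite ler_wpM2l//.
  by move: l2; rewrite -natr1; move: l1'; clear; lra.
(* Stopping at [1 - 1 / nu] keeps [(th j)^-1 <= nu]. Steps of at most [1 / n] change [th] so little
   that the effect over all [n] letters is bounded. *)
have [b [b0 bn bitv bstep]] := order_grid n_gt0 a0_gt0 nu0 nua.
have nV : 0 < nu^-1 by rewrite invr_gt0.
have b01 j : 0 < b j < 1.
  by have /andP[h1 h2] := bitv j; move: a0_gt0 nV h1 h2; clear => *; apply/andP; split; lra.
pose th j := (1 - b j) / b j.
have thE j : th j = (1 - b j) / b j by [].
have thj j : [/\ 0 < th j, th j <= A & (th j)^-1 <= nu].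
  have /andP[h1 h2] := bitv j.
  by have [h3 h4 h5 _ _] := theta_bounds a0_gt0 nu0 h1 (lexx _) h2; rewrite AE.
have thS j : (j < n)%N -> th j.+1 <= th j /\ th j - th j.+1 <= n%:R^-1 * A ^+ 2.
  move=> jn; have /andP[h1 h2] := bitv j; have /andP[h3 h4] := bitv j.+1.
  have /andP[h5 h6] := bstep j jn.
  have [_ _ _ h7 h8] := theta_bounds a0_gt0 nu0 h1 h5 h4; split=> //.
  by apply: (le_trans h8); rewrite -AE ler_wpM2r ?sqr_ge0// lerBlDl.
have thn : th n <= A * nu^-1.
  rewrite /th AE [leRHS]mulrC; have /andP[h1 h2] := bitv n.
  have -> : 1 - b n = nu^-1 by rewrite bn opprB addrCA subrr addr0.
  rewrite ler_wpM2l ?(ltW nV)// lef_pV2 ?posrE//; exact: lt_le_trans a0_gt0 h1.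
clearbody th.
(* Bounds the capacity of every window of length [m >= n0], wherever it starts. *)
pose c j (m : nat) := m%:R * g (b j) + K * ln m%:R.
have lnm (m : nat) : (0 < m)%N -> (0 <= ln m%:R :> R) /\ (ln m%:R <= m%:R :> R).
  by move=> m0; rewrite ln_ge0 ?ler1n// ltW// ln_sublinear// ltr0n.
have c0 j m : (0 < m)%N -> 0 <= c j m /\ c j m <= m%:R * B.
  move=> m0; have [h1 h2] := lnm m m0.
  have h3 := g0 _ (b01 j); have h4 := gG _ (b01 j).
  rewrite /c addr_ge0 ?mulr_ge0//; split=> //; rewrite BE mulrDr lerD ?ler_wpM2l//.
  by rewrite [leRHS]mulrC ler_wpM2l.
have hCj j : n%:R * g (b j) <= cap (b j) + K * lnn /\ cap (b j) <= n%:R * g (b j) + K * lnn.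
  have := capn _ (b01 j); rewrite ler_norml => /andP[h1 h2].
  by move: h1 h2; clear => h1 h2; split; lra.
have cn j : cap (b j) <= n%:R * B.
  by apply: le_trans (hCj j).2 _; have [_] := c0 j n n_gt0; rewrite /c lnnE.
have r0B : r0 <= n%:R * B.
  apply: (le_trans hr1); have := capn _ a11; rewrite ler_norml lerBlDl => /andP[_ h2].
  apply: (le_trans h2); have [_ h3] := lnm n n_gt0; rewrite lnnE in h3.
  rewrite BE mulrDr lerD ?ler_wpM2l//; first exact: gG.
  by rewrite [leRHS]mulrC ler_wpM2l.
have Kln0 : 0 <= K * lnn by rewrite mulr_ge0.
have Knu : K * lnn + 2 * nu ^+ 2 * (K * lnn) <= nu ^+ 3 * (K * lnn).
  rewrite -[X in X + _ <= _]mul1r -mulrDl ler_wpM2r//.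
  by move: nu21 nu23; clear; lra.
have C1nu : C1 * nu ^+ 3 <= nu ^+ 3 * lnn by rewrite mulrC ler_wpM2l.
(* The rate gap [(K + 1) nu^3 ln n] is spent in two parts: [K] pays for the capacity errors of the
   whole and of the blocks, and 1 pays for [C1], as [C1 <= ln n]. *)
have hr0' : n%:R * g a0 + C1 * nu ^+ 3 + 2 * nu ^+ 2 * (K * lnn) <= r0.
  have [h _] := hCj 0%N; rewrite b0 in h.
  by move: h hr0 Knu C1nu; clear; lra.
have C1nu0 : 0 < C1 * nu ^+ 3.
  by move: (ler_pM (ler0n _ 408) (ler0n _ 27) C10 nu33); clear; lra.
have ng0 : 0 <= n%:R * g a0 by rewrite mulr_ge0//; exact: g0.
have nuK0 : 0 <= 2 * nu ^+ 2 * (K * lnn) by apply: mulr_ge0 => //; exact: mulr_ge0.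
have rC0 : C1 * nu ^+ 3 <= r0 by move: hr0' ng0 nuK0; clear; lra.
have [M0 LM] := hML (lt_le_trans C1nu0 rC0).
have nB : 0 <= n%:R * B by rewrite mulr_ge0.
have ABn0 : 0 <= A * (n%:R * B) by rewrite mulr_ge0.
(* Order 1 contributes the term 0. *)
have Esp0 : (0 <= Esp r0 (prod_chan (@W) 1 n))%E.
  by have := Esp_ge 1 ltr01; rewrite subrr mul0r mul0r.
have [E0 [/andP[E00 E0AB] E0Esp hE0]] := ereal_truncate Esp0 ABn0.
exists E0 => //.
have thE0 j : th j * (cap (b j) - r0) <= E0.
  have [t0 tA _] := thj j; have /andP[b0' _] := b01 j.
  apply: hE0; first by rewrite thE; exact: Esp_ge.
  apply: (@le_trans _ _ (th j * (n%:R * B))); last exact: ler_wpM2r.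
  apply: ler_wpM2l; first exact: ltW.
  by apply: le_trans (cn j); rewrite gerDl oppr_le0; exact: le_trans (ltW C1nu0) rC0.
(* [C1 = 12 + T] covers [10 nu^3] for the block costs [ln (n + 1)], [T nu^3] for fluctuations and a
   slack of [2 nu^3]. In [C2], [A (12 K + C1)] covers capacity errors and the lowered rate, [A^2 B]
   the grid step and [A B] the last order. *)
set r := (r0 - C1 * nu ^+ 3) / n%:R.
set e := (E0 + C2 * nu ^+ 3) / n%:R.
have nr : n%:R * r = r0 - C1 * nu ^+ 3 by rewrite /r mulrC divfK// lt0r_neq0.
have ne : n%:R * e = E0 + C2 * nu ^+ 3 by rewrite /e mulrC divfK// lt0r_neq0.
have r_ge0 : 0 <= r by rewrite divr_ge0 ?(ltW N0)// subr_ge0.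
have e_ge0 : 0 <= e by rewrite divr_ge0 ?(ltW N0)// addr_ge0// mulr_ge0.
clearbody r e.
have nmul (u v : R) : n%:R * u <= n%:R * v -> u <= v by rewrite ler_pM2l.
have scale (m : nat) : (l <= m)%N -> (m < 2 * l)%N ->
    0 < m%:R :> R /\ forall j, n%:R * (c j m / m%:R) <= n%:R * g (b j) + 2 * nu ^+ 2 * (K * lnn).
  move=> m1 m2; have m0 : (0 < m)%N := leq_trans l_gt0 m1.
  have m0' : (0 : R) < m%:R by rewrite ltr0n.
  split=> // j; rewrite /c mulrDl [_ * g _]mulrC mulfK ?lt0r_neq0// mulrDr lerD2l.
  have mn : (m <= n)%N := leq_trans (ltnW m2) l2n.
  have h1 : ln m%:R <= lnn by rewrite -lnnE ler_ln ?posrE// ler_nat.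
  have h2 : n%:R / m%:R <= 2 * nu ^+ 2.
    apply: le_trans nl; rewrite ler_pM2l// lef_pV2 ?posrE//.
    by rewrite ler_nat.
  have h3 : 0 <= n%:R / m%:R :> R by rewrite divr_ge0.
  have h4 : K * ln m%:R <= K * lnn by rewrite ler_wpM2l.
  have h5 : 0 <= K * ln m%:R by rewrite mulr_ge0// ln_ge0// ler1n.
  rewrite (_ : n%:R * (K * ln m%:R / m%:R) = n%:R / m%:R * (K * ln m%:R)); last by ring.
  exact: ler_pM.
have cost (m : nat) : (l <= m)%N -> (m < 2 * l)%N -> forall (x y : R),
    n%:R * (x * (y / m%:R - r)) <= E0 + C2 * nu ^+ 3 -> x * (y - m%:R * r) <= m%:R * e.
  move=> m1 m2 x y h; have [m0 _] := scale m m1 m2.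
  have -> : x * (y - m%:R * r) = m%:R * (x * (y / m%:R - r)).
    by move: m0; clear => m0; field; rewrite lt0r_neq0.
  by rewrite ler_pM2l//; apply: nmul; rewrite ne.
have base (m j : nat) : (l <= m)%N -> (m < 2 * l)%N ->
    n%:R * (th j * (c j m / m%:R - r)) <= E0 + A * (12 * K + C1) * nu ^+ 3.
  move=> m1 m2; have [m0 /(_ j) h] := scale m m1 m2.
  have [t0 tA _] := thj j; have [h1 _] := hCj j.
  (* The error [(1 + 2 nu^2) K ln n] is at most [3 nu^2 K (4 nu)], whence [12 K]. *)
  have h2 : n%:R * (c j m / m%:R - r) <= (cap (b j) - r0) + (12 * K + C1) * nu ^+ 3.
    have h3 := ler_wpM2l (mulr_ge0 nu2_ge0 K0) lnn4.
    have h4 := ler_wpM2r Kln0 nu21.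
    have h5 : nu ^+ 2 * K * (4 * nu) = 4 * K * nu ^+ 3 by ring.
    rewrite h5 in h3; rewrite mulrBr nr.
    by move: h h1 h3 h4; clear; lra.
  have h3 := ler_wpM2l (ltW t0) h2.
  have h4 : th j * ((12 * K + C1) * nu ^+ 3) <= A * ((12 * K + C1) * nu ^+ 3).
    by apply: ler_wpM2r => //; rewrite mulr_ge0.
  by move: (thE0 j) h3 h4; clear; lra.
have e_le : e <= A * B + 1.
  apply: nmul; rewrite ne mulrDr mulr1 lerD//; first by rewrite mulrCA.
  by rewrite nE nu34 mulrC ler_wpM2l.
have r_le : r <= B.
  by apply: nmul; rewrite nr; apply: le_trans r0B; rewrite gerDl oppr_le0 ltW.
have mle (m : nat) : (m < 2 * l)%N -> m%:R <= 2 * nu ^+ 2.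
  move=> h; apply: (@le_trans _ _ (2 * l%:R)); last by rewrite ler_pM2l.
  by rewrite -natrM ler_nat ltnW.
have lnS : 0 <= ln (n.+1%:R : R) <= 5 * nu.
  apply/andP; split; first by apply: ln_ge0; rewrite ler1n.
  have h : n.+1%:R <= n%:R * expR 1 :> R.
    apply: (@le_trans _ _ (n%:R * (1 + 1))); last by rewrite ler_wpM2l// expR_ge1Dx.
    by rewrite mulrDr mulr1 -natr1 lerD2l ler1n.
  apply: (@le_trans _ _ (ln (n%:R * expR 1))).
    by rewrite ler_ln ?posrE ?mulr_gt0 ?expR_gt0// ltr0n.
  rewrite lnM ?posrE ?expR_gt0// expRK lnnE; move: lnn4 nu3; clear; lra.
have nu4_gt0 : 0 < nu ^+ 4 by rewrite exprn_gt0.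
have S0 : 0 <= Cv * nu ^+ 4 by rewrite mulr_ge0 ?(ltW nu4_gt0).
have tau0 : 0 < T * nu ^+ 3.
  by move: (ler_pM (ler0n _ 408) (ler0n _ 27) T0 nu33); clear; lra.
(* At most [2 nu^2] blocks of variance [Cv nu^4] give [16 Cv nu^6], and [T = 4 Cv] with [Cv >= 1]
   suffices. *)
have htau : 8 * (n%:R * (Cv * nu ^+ 4 / l%:R)) <= (T * nu ^+ 3) ^+ 2.
  have -> : 8 * (n%:R * (Cv * nu ^+ 4 / l%:R)) = 8 * (Cv * nu ^+ 4) * (n%:R / l%:R) by ring.
  apply: (@le_trans _ _ (8 * (Cv * nu ^+ 4) * (2 * nu ^+ 2))).
    by apply: ler_wpM2l nl; rewrite mulr_ge0.
  have -> : 8 * (Cv * nu ^+ 4) * (2 * nu ^+ 2) = 16 * Cv * nu ^+ 6 by ring.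
  have -> : (T * nu ^+ 3) ^+ 2 = 16 * (Cv * Cv) * nu ^+ 6 by rewrite TE; ring.
  rewrite ler_wpM2r ?exprn_ge0 ?(ltW nu0)// ler_pM2l// ler_peMr//.
  by move: Cv1; clear; lra.
have h1 : n%:R * (r + ln n.+1%:R / l%:R) + T * nu ^+ 3 <= r0 - 2.
  have h2 : n%:R / l%:R * ln n.+1%:R <= 2 * nu ^+ 2 * (5 * nu).
    by have /andP[? ?] := lnS; apply: ler_pM => //; rewrite divr_ge0.
  have h3 : 2 * nu ^+ 2 * (5 * nu) = 10 * nu ^+ 3 by ring.
  have -> : n%:R * (r + ln n.+1%:R / l%:R) = n%:R * r + n%:R / l%:R * ln n.+1%:R by ring.
  by rewrite h3 in h2; rewrite nr C1E; move: h2 nu33; clear; lra.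
have h2 : 3 / 4 <= expR (n%:R * e + T * nu ^+ 3) * avg_err (fb_chan (@W) n) f psi +
    expR (n%:R * (r + ln n.+1%:R / l%:R) + T * nu ^+ 3) * (L%:R / M%:R).
  have hl : (0 < l <= n)%N by rewrite l_gt0 (leq_trans _ l2n)// leq_pmull.
  apply: (@feedback_converse R X Y W hW hX n n b c l (2 * nu ^+ 2 * B) A nu e r
    (Cv * nu ^+ 4) (T * nu ^+ 3) M L f psi b01 _ _ hl S0 _ tau0 htau M0 hpsi).
  - move=> j m s _ m1 m2 s0.
    have n0m : (n0 <= m)%N := leq_trans (ltnW l_n0) m1.
    by have := hcap _ n0m _ (b01 j) _ s0; rewrite ler_norml => /andP[_]; rewrite lerBlDl.
  - by move=> j jn; have [] := thS j jn; rewrite !thE.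
  move=> m m1 m2; have [m0 hsc] := scale m m1 m2.
  have m0' : (0 < m)%N := leq_trans l_gt0 m1.
  have mnu := mle m m2.
  split.
  - rewrite -ler_pdivrMl// mulrC; apply: nmul; rewrite nr; apply: le_trans (hsc 0%N) _.
    by rewrite b0; move: hr0'; clear; lra.
  - move=> j jn; have [tm td] := thS j jn; rewrite -thE; split; apply: cost => //.
      apply: le_trans (base m j m1 m2) _; rewrite lerD2l ler_wpM2r//.
      by rewrite C2E -addrA lerDl addr_ge0.
    have h := base m j.+1 m1 m2.
    have cB : c j.+1 m / m%:R - r <= B.
      have [_ hh] := c0 j.+1 m m0'.
      apply: (@le_trans _ _ (c j.+1 m / m%:R)); first by rewrite gerDl oppr_le0.
      by rewrite ler_pdivrMr// mulrC.
    (* The price of using the factor [th j] with the capacity of the next order. *)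
    have h3 : (th j - th j.+1) * (n%:R * (c j.+1 m / m%:R - r)) <= A ^+ 2 * B.
      have t0 : 0 <= th j - th j.+1 by rewrite subr_ge0.
      apply: (@le_trans _ _ ((th j - th j.+1) * (n%:R * B))).
        by do 2!apply: ler_wpM2l => //; exact: ltW.
      apply: le_trans (ler_wpM2r nB td) _.
      rewrite (_ : n%:R^-1 * A ^+ 2 * (n%:R * B) = A ^+ 2 * B)//.
      by move: N0; clear => N0; field; rewrite lt0r_neq0.
    have h4 : A ^+ 2 * B <= A ^+ 2 * B * nu ^+ 3.
      by rewrite ler_peMr//; move: nu33; clear; lra.
    have h5 := mulr_ge0 AB nu3_ge0.
    by rewrite C2E; move: h h3 h4 h5; clear; lra.
  (* At the last order [th n <= A / nu], so the whole divergence costs at most [A B nu^3] over [n]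
     letters. *)
  - have [t0 tA _] := thj n; have [cn0 cnB] := c0 n m m0'; rewrite -thE.
    have h2 : th n * c n m <= A * nu^-1 * (m%:R * B) by apply: ler_pM => //; exact: ltW.
    apply: (le_trans h2).
    rewrite [leLHS](_ : _ = m%:R * (A * B * nu^-1)); last by ring.
    rewrite ler_pM2l//; apply: nmul; rewrite ne nE nu34.
    rewrite [leLHS](_ : _ = A * B * nu ^+ 3); last first.
      by move: nu0; clear => nu0; field; rewrite lt0r_neq0.
    rewrite -[leLHS]add0r lerD// ler_wpM2r// C2E lerDr addr_ge0//.
  - move=> j _; have [t0 tA tn] := thj j; have [_ cjB] := c0 j m m0'; rewrite -thE.
    by split=> //; apply: (le_trans cjB); rewrite ler_wpM2r.
  - have nu1 : 1 <= nu by move: nu3; clear; lra.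
    have [||v1 v2] := variance_bound nu1 A_ge0 B0 _ _ lnS (m := m%:R) (e := e) (r := r).
    + by rewrite mulr_ge0 ?(ltW m0)//= ler_pM// ltW.
    + by rewrite mulr_ge0 ?(ltW m0)//= ler_pM// ltW.
    have w1 := mulr_ge0 CvA (ltW nu4_gt0).
    have w2 := mulr_ge0 (le_trans (ler0n _ 102) CvB) (ltW nu4_gt0).
    rewrite CvE [_ * nu ^+ 4]mulrDl; split.
      by apply: (le_trans v1); rewrite lerDl.
    by apply: (le_trans v2); rewrite lerDr.
move: (avg_err _ _ _) h2 => P h2.
have e1 : 2 <= expR 1 :> R by exact: expR_ge1Dx.
have e2 : expR (- 2) <= 1 / 4 :> R.
  rewrite expRN (_ : 2 = 1 + 1 :> R)// expRD div1r lef_pV2 ?posrE ?mulr_gt0 ?expR_gt0//.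
  rewrite (_ : 4 = 2 * 2 :> R); first exact: ler_pM.
  by rewrite -natrM.
(* Since [L / M = exp (- r0)] and the exponent is at most [r0 - 2], correct decoding accounts for at
   most 1/4 of the 3/4. *)
have h3 : expR (n%:R * (r + ln n.+1%:R / l%:R) + T * nu ^+ 3) * (L%:R / M%:R) <= 1 / 4.
  rewrite LM -expRD; apply: le_trans e2; rewrite ler_expR.
  by move: h1; clear; lra.
have h4 : 1 / 2 <= expR (n%:R * e + T * nu ^+ 3) * P by move: h2 h3; clear; lra.
have -> : - (E0 + (C2 + T + 1) * nu ^+ 3) = - nu ^+ 3 - (n%:R * e + T * nu ^+ 3).
  by rewrite ne; ring.
rewrite expRB ler_pdivrMr ?expR_gt0// mulrC; apply: le_trans h4.
apply: (@le_trans _ _ (expR (- 1))).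
  by rewrite ler_expR lerN2; move: nu33; clear; lra.
by rewrite expRN div1r lef_pV2 ?posrE ?expR_gt0.
Qed.

(** * Large blocklengths *)

Lemma root4 {R : realType} (n : nat) (nu := n%:R `^ (4^-1) : R) :
  n%:R = nu ^+ 4 /\ n%:R `^ (3 / 4) = nu ^+ 3.
Proof.
have nu0 : 0 <= nu by exact: powR_ge0.
split; rewrite -powR_mulrn// -powRrM; last by congr powR; field.
by rewrite mulVf ?powRr1// pnatr_eq0.
Qed.

Unset Implicit Arguments.

Theorem theorem5 (R : realType)
  (X Y : nat -> finType) (W : forall t, X t -> Y t -> R)
  (HW : forall t, (0 < t)%N -> is_channel (W t))
  (HX : forall t, (0 < t)%N -> (0 < #|X t|)%N)
  (g : R -> R)
  (Hg0 : forall a, 0 < a < 1 -> 0 <= g a)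
  (Hi : forall a, 0 < a < 1 ->
     (fun n : nat => (n%:R)^-1 * renyi_cap a (prod_chan W 1 n)) @ \oo --> g a)
  (Hii : (fun a => (1 - a) / a * g a) @ 1^'- --> 0)
  (K : R) (n0 : nat) (HK : 0 <= K) (Hn0 : (0 < n0)%N)
  (Hiii : forall n, (n0 <= n)%N -> forall a, 0 < a < 1 -> forall t, (0 < t)%N ->
     `|renyi_cap a (prod_chan W t n) - n%:R * g a| <= K * ln (n%:R))
  (a0 a1 : R) (Ha : 0 < a0 < a1) (Ha1 : a1 < 1)
  (M L : nat -> nat) (HL : forall n, (0 < n)%N -> (0 < L n)%N)
  (f : forall n, 'I_(M n) -> fb_in X Y n)
  (psi : forall n, fb_out Y n -> {set 'I_(M n)})
  (Hpsi : forall n, (0 < n)%N -> forall y, #|psi n y| = L n)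
  (Hrate : forall n, (n0 <= n)%N ->
     renyi_cap a1 (prod_chan W 1 n) >= ln ((M n)%:R / (L n)%:R) /\
     ln ((M n)%:R / (L n)%:R) >= renyi_cap a0 (prod_chan W 1 n)
                     + (K + 1) * (n%:R `^ (3 / 4)) * ln (n%:R)) :
  exists n1 : nat, (n0 <= n1)%N /\ forall n, (n1 <= n)%N ->
    ((avg_err (fb_chan W n) (f n) (psi n))%:E >=
     expeR (- Esp (ln ((M n)%:R / (L n)%:R)) (prod_chan W 1 n)
            - ((6 * K + 1) / a0 * (n%:R `^ (3 / 4)) * ln (n%:R))%:E))%E.
Proof.
have a0_gt0 : 0 < a0 by case/andP: Ha.
have a01 : 0 < a0 < 1 by rewrite a0_gt0; case/andP: Ha => _ h; exact: lt_trans h Ha1.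
have a11 : 0 < a1 < 1 by rewrite Ha1 andbT; case/andP: Ha => _ h; exact: lt_trans h.
have [G G0 gG] := g_bounded HW HX Hg0 Hn0 Hiii.
have [A AE] : exists A, A = a0^-1 by eexists.
have [B BE] : exists B, B = G + K by eexists.
have [Cv CvE] : exists Cv, Cv = (4 * A ^+ 2 * (4 * B ^+ 2 + 1) + 2 + 8 * (A * B + 1) ^+ 2) +
    (8 * (4 * B ^+ 2 + 1) + 102 + 2 * (2 * B + 5) ^+ 2) by eexists.
have [T TE] : exists T, T = 4 * Cv by eexists.
have [C1 C1E] : exists C1, C1 = 12 + T by eexists.
have [C2 C2E] : exists C2, C2 = A * (12 * K + C1) + A ^+ 2 * B + A * B by eexists.
(* [Z0] gathers the lower bounds required of [nu], and [Z] those of [ln n]. As [ln n <= 4 nu], the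
   condition [ln n >= Z] implies both. *)
pose Z0 := n0%:R + 4 + `|C2| + (1 - a0)^-1.
pose Z := 4 * Z0 + `|C1| + `|C2 + T + 1|.
have V0 : 0 < (1 - a0)^-1 by rewrite invr_gt0 subr_gt0; case/andP: a01.
exists (n0 + (Num.truncn (expR Z)).+1)%N; split; first exact: leq_addr.
move=> n hn.
have n0n : (n0 <= n)%N := leq_trans (leq_addr _ _) hn.
have n_gt0 : (0 < n)%N := leq_trans Hn0 n0n.
have Zn : Z <= ln n%:R.
  rewrite -[leLHS]expRK ler_ln ?posrE ?expR_gt0 ?ltr0n//.
  apply: ltW; apply: lt_le_trans (truncnS_gt _) _.
  by rewrite ler_nat; apply: leq_trans hn; exact: leq_addl.
pose nu : R := n%:R `^ (4^-1).
have [nE n34] := @root4 R n; rewrite -/nu in nE n34.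
have nu0 : 0 < nu by rewrite powR_gt0// ltr0n.
have lnu := ln_le_root n_gt0 nu0 nE.
clearbody nu.
have Z1 : Z0 <= nu.
  have h1 := normr_ge0 C1; have h2 := normr_ge0 (C2 + T + 1).
  by move: lnu Zn h1 h2; rewrite /Z; clear; lra.
have [hn0 h4 hC2 hV] : [/\ n0%:R + 1 <= nu, 3 <= nu, C2 <= nu & (1 - a0)^-1 < nu].
  have h1 := ler_norm C2; have h2 := normr_ge0 C2; have h3 : (0 : R) <= n0%:R by [].
  move: Z1 h1 h2 h3 V0; rewrite /Z0; clear.
  by move=> *; split; lra.
have [hC1 hD] : C1 <= ln n%:R /\ C2 + T + 1 <= ln n%:R.
  have h1 := ler_norm C1; have h2 := ler_norm (C2 + T + 1).
  have h3 := normr_ge0 C1; have h4' := normr_ge0 (C2 + T + 1).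
  have h5 : 0 <= Z0 by rewrite /Z0 !addr_ge0// ltW.
  move: Zn h1 h2 h3 h4' h5; rewrite /Z.
  by clear; move=> *; split; lra.
have nua : 1 < nu * (1 - a0).
  by rewrite -ltr_pdivrMr ?subr_gt0 ?div1r//; case/andP: a01.
have [hr1 hr0] := Hrate n n0n; rewrite n34 in hr0 *.
have [E0 hE0 hP] := @blocklength_bound R X Y W g K n0 a0 a1 G A B Cv T C1 C2 n nu _ _
  (f n) (psi n) HW HX Hg0 HK Hn0 Hiii a01 a11 G0 gG AE BE CvE TE C1E C2E
  n0n nE h4 hn0 nua hC2 hC1 (HL n n_gt0) (Hpsi n n_gt0) hr1 hr0.
set X0 := (6 * K + 1) / a0 * nu ^+ 3 * ln n%:R.
(* For large [n] the constant is below [ln n], and [(6 K + 1) / a0 >= 1]. *)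
have hX0 : (C2 + T + 1) * nu ^+ 3 <= X0.
  have nu3 : 0 <= nu ^+ 3 by rewrite exprn_ge0// ltW.
  have ln0 : 0 <= ln n%:R :> R by rewrite ln_ge0// ler1n.
  apply: (@le_trans _ _ (nu ^+ 3 * ln n%:R)); first by rewrite mulrC ler_wpM2l.
  have k1 : 1 <= (6 * K + 1) / a0.
    rewrite ler_pdivlMr// mul1r; case/andP: a01 => _ /ltW /le_trans; apply.
    by rewrite lerDr mulr_ge0.
  have -> : X0 = (6 * K + 1) / a0 * (nu ^+ 3 * ln n%:R) by rewrite /X0; ring.
  by rewrite ler_peMl// mulr_ge0.
have hle : (expeR (- Esp (ln ((M n)%:R / (L n)%:R)) (prod_chan W 1 n) - X0%:E) <=
    (expR (- (E0 + (C2 + T + 1) * nu ^+ 3)))%:E)%E.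
  rewrite -[leRHS]/(expeR (- (E0 + (C2 + T + 1) * nu ^+ 3))%:E) lee_expeR.
  rewrite opprD EFinD; apply: leeD; last by rewrite lee_fin lerN2.
  by rewrite EFinN leeN2.
by apply: le_trans hle _; rewrite lee_fin.
Qed.
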